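(* The 2-category $\mathrm{qCat}_2$ admits weak 2-pullbacks along isofibrations: let $f\colon B\to A$ be a functor and $g\colon C\to A$ an isofibration between quasi-categories, and let $B\times_AC$ be their pullback in simplicial sets, with projections $\pi_1\colon B\times_AC\to B$, $\pi_2\colon B\times_AC\to C$. Then $B\times_AC$ is a quasi-category and it is a weak 2-pullback of $g$ along $f$ in $\mathrm{qCat}_2$; that is, for every quasi-category $X$ the canonical functor $$\hom'(X,B\times_AC)\longrightarrow\hom'(X,B)\times_{\hom'(X,A)}\hom'(X,C)$$ induced by composition with $\pi_1$ and $\pi_2$ is a smothering functor.
   Context: A quasi-category is a simplicial set with fillers for all inner horns; functors are simplicial maps between quasi-categories. $\mathrm{qCat}_2$ is the strict 2-category of quasi-categories with hom-categories $\hom'(A,B)=h(B^A)$, where $B^A$ is the internal hom of simplicial sets and $h\colon\mathrm{sSet}\to\mathrm{Cat}$ is left adjoint to the nerve. An isofibration is a functor between quasi-categories with the right lifting property against all inner horn inclusions $\Lambda^{n,k}\hookrightarrow\Delta^n$ ($n\ge2$, $0<k<n$) and against an inclusion $\Delta^0\hookrightarrow\mathbb I$ of an endpoint into the nerve $\mathbb I$ of the category consisting of two objects and a unique isomorphism between them. A functor between categories is smothering if it is surjective on objects, full, and conservative (reflects isomorphisms). *)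

(* Defs.v *)
From HB Require Import structures.
From mathcomp Require Import all_boot boolp.

Set Implicit Arguments.
Unset Strict Implicit.
Unset Printing Implicit Defensive.

Local Open Scope quotient_scope.

Lemma sval_eq (T : Type) (P : T -> Prop) (u v : {x : T | P x}) :
  sval u = sval v -> u = v.
Proof. by apply: eq_sig_hprop => x p q. Qed.

Record category := Category {
  obj :> Type;
  hom : obj -> obj -> Type;
  idm : forall a, hom a a;
  mcomp : forall a b c, hom b c -> hom a b -> hom a c;
  mcomp_idl : forall a b (u : hom a b), mcomp (idm b) u = u;
  mcomp_idr : forall a b (u : hom a b), mcomp u (idm a) = u;
  mcompA : forall a b c d (w : hom c d) (v : hom b c) (u : hom a b),
    mcomp w (mcomp v u) = mcomp (mcomp w v) u
}.
Arguments hom {c0} _ _ : rename.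
Arguments idm {c0} a : rename.
Arguments mcomp {c0 a b c} _ _ : rename.

Definition is_iso (C : category) (a b : C) (u : hom a b) : Prop :=
  exists v : hom b a, mcomp v u = idm a /\ mcomp u v = idm b.

(** [arr u = arr v] states that [u] and [v] are equal as arrows (same source,
    same target, same morphism) when their endpoints are only provably equal. *)
Definition arr (C : category) (a b : C) (u : hom a b) :
    {p : C * C & hom p.1 p.2} :=
  existT (fun p : C * C => hom p.1 p.2) (a, b) u.

Lemma arr_ind (C : category) (a b : C) (u : hom a b)
    (P : forall a' b' : C, hom a' b' -> Prop) :
  P a b u -> forall (a' b' : C) (v : hom a' b'), arr u = arr v -> P a' b' v.
Proof.
move=> Pu a' b' v e.
have : (fun s : {p : C * C & hom p.1 p.2} => P _ _ (projT2 s)) (arr u) by [].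
by rewrite e.
Qed.

Lemma arr_inj (C : category) (a b : C) (u v : hom a b) : arr u = arr v -> u = v.
Proof.
pose P (a' b' : C) (w : hom a' b') := forall (p : a = a') (q : b = b'),
  eq_rect b (hom a') (eq_rect a (hom^~ b) u a' p) b' q = w.
move=> e; have /(_ erefl erefl) // : P a b v.
apply: (arr_ind _ e) => p q.
by rewrite (Prop_irrelevance p erefl) (Prop_irrelevance q erefl).
Qed.

Lemma arr_mcomp (C : category) (a b c a' b' c' : C) (v : hom b c) (u : hom a b)
    (v' : hom b' c') (u' : hom a' b') :
  arr v = arr v' -> arr u = arr u' -> arr (mcomp v u) = arr (mcomp v' u').
Proof.
move=> ev eu; have eb : b = b' := congr1 (fun s => (projT1 s).1) ev.
have ec : c = c' := congr1 (fun s => (projT1 s).2) ev.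
have ea : a = a' := congr1 (fun s => (projT1 s).1) eu.
by subst; rewrite (arr_inj ev) (arr_inj eu).
Qed.

Record functor (C D : category) := Functor {
  fobj :> C -> D;
  fmap : forall a b : C, hom a b -> hom (fobj a) (fobj b);
  fmap_id : forall a : C, fmap (idm a) = idm (fobj a);
  fmap_comp : forall (a b c : C) (v : hom b c) (u : hom a b),
    fmap (mcomp v u) = mcomp (fmap v) (fmap u)
}.
Arguments fmap {C D} f {a b} _ : rename.

Lemma functor_eq (C D : category) (F G : functor C D) :
  (forall (a b : C) (u : hom a b), arr (fmap F u) = arr (fmap G u)) -> F = G.
Proof.
case: F G => [Fo Fm Fi Fc] [Go Gm Gi Gc] /= e.
have eo : Fo = Go.
  by apply/funext => a; exact: (congr1 (fun s => (projT1 s).1) (e _ _ (idm a))).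
subst Go; have em : Fm = Gm.
  apply functional_extensionality_dep => a; apply functional_extensionality_dep => b.
  by apply: funext => u; apply: arr_inj.
by subst Gm; rewrite (Prop_irrelevance Fi Gi) (Prop_irrelevance Fc Gc).
Qed.

Lemma arr_fmap (C D : category) (F : functor C D) (a b a' b' : C)
    (u : hom a b) (v : hom a' b') :
  arr u = arr v -> arr (fmap F u) = arr (fmap F v).
Proof. by move=> e; apply: (arr_ind (P := fun a b w => _ = arr (fmap F w)) _ e). Qed.

Section FunctorComposition.
Variables (C D E : category) (G : functor D E) (F : functor C D).

Lemma fcomp_id (a : C) : fmap G (fmap F (idm a)) = idm (G (F a)).
Proof. by rewrite !fmap_id. Qed.

Lemma fcomp_comp (a b c : C) (v : hom b c) (u : hom a b) :
  fmap G (fmap F (mcomp v u)) = mcomp (fmap G (fmap F v)) (fmap G (fmap F u)).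
Proof. by rewrite !fmap_comp. Qed.

Definition fcomp : functor C E := Functor fcomp_id fcomp_comp.

End FunctorComposition.

Definition surjective_on_objects (C D : category) (F : functor C D) : Prop :=
  forall d : D, exists c : C, F c = d.

Definition full (C D : category) (F : functor C D) : Prop :=
  forall (a b : C) (v : hom (F a) (F b)), exists u : hom a b, fmap F u = v.

Definition conservative (C D : category) (F : functor C D) : Prop :=
  forall (a b : C) (u : hom a b), is_iso (fmap F u) -> is_iso u.

Definition smothering (C D : category) (F : functor C D) : Prop :=
  [/\ surjective_on_objects F, full F & conservative F].

Section CategoryPullback.
Variables (B C A : category) (F : functor B A) (G : functor C A).

Definition cpb_obj := {p : B * C | F p.1 = G p.2}.

Definition cpb_hom (p q : cpb_obj) :=
  {w : hom (sval p).1 (sval q).1 * hom (sval p).2 (sval q).2 |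
    arr (fmap F w.1) = arr (fmap G w.2)}.

Lemma cpb_idm_proof (p : cpb_obj) :
  arr (fmap F (idm (sval p).1)) = arr (fmap G (idm (sval p).2)).
Proof. by rewrite !fmap_id (svalP p). Qed.

Definition cpb_idm (p : cpb_obj) : cpb_hom p p :=
  exist _ (idm (sval p).1, idm (sval p).2) (cpb_idm_proof p).

Lemma cpb_comp_proof (p q r : cpb_obj) (v : cpb_hom q r) (u : cpb_hom p q) :
  arr (fmap F (mcomp (sval v).1 (sval u).1)) =
  arr (fmap G (mcomp (sval v).2 (sval u).2)).
Proof.
by rewrite !fmap_comp; apply: arr_mcomp; [exact: (svalP v) | exact: (svalP u)].
Qed.

Definition cpb_comp (p q r : cpb_obj) (v : cpb_hom q r) (u : cpb_hom p q) :
    cpb_hom p r :=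
  exist _ (mcomp (sval v).1 (sval u).1, mcomp (sval v).2 (sval u).2)
    (cpb_comp_proof v u).

Definition cat_pullback : category.
Proof.
refine (@Category cpb_obj cpb_hom cpb_idm cpb_comp _ _ _).
- by move=> p q [[u v] e]; apply: sval_eq; rewrite /= !mcomp_idl.
- by move=> p q [[u v] e]; apply: sval_eq; rewrite /= !mcomp_idr.
- by move=> p q r s w v u; apply: sval_eq; rewrite /= !mcompA.
Defined.

Section Pairing.
Variables (T : category) (H : functor T B) (K : functor T C).
Hypothesis sq : fcomp F H = fcomp G K.

Definition cat_pair_obj (t : T) : cat_pullback :=
  exist _ (H t, K t) (congr1 (fun L : functor T A => L t) sq).

Definition cat_pair_map (s t : T) (u : hom s t) :
    hom (cat_pair_obj s) (cat_pair_obj t) :=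
  exist _ (fmap H u, fmap K u) (congr1 (fun L : functor T A => arr (fmap L u)) sq).

Definition cat_pair : functor T cat_pullback.
Proof.
refine (@Functor T cat_pullback cat_pair_obj cat_pair_map _ _).
- by move=> t; apply: sval_eq; rewrite /= !fmap_id.
- by move=> r s t v u; apply: sval_eq; rewrite /= !fmap_comp.
Defined.

End Pairing.
End CategoryPullback.

(** [simplex_map m n] is the set of morphisms [m] -> [n] of the simplex
    category, where [n] = {0 < ... < n} is the ordinal type ['I_n.+1]. *)
Record simplex_map (m n : nat) := SimplexMap {
  sfun :> 'I_m.+1 -> 'I_n.+1;
  sfun_mono : forall i j : 'I_m.+1, i <= j -> sfun i <= sfun j
}.

Lemma simplex_map_eq (m n : nat) (a b : simplex_map m n) :
  (forall i, a i = b i) -> a = b.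
Proof.
case: a b => [a ma] [b mb] /= /funext e; subst b.
by rewrite (Prop_irrelevance ma mb).
Qed.

Definition simplex_id (n : nat) : simplex_map n n :=
  @SimplexMap n n id (fun i j h => h).

Definition simplex_comp (l m n : nat) (b : simplex_map m n) (a : simplex_map l m) :
    simplex_map l n :=
  @SimplexMap l n (fun i => b (a i)) (fun i j h => sfun_mono b (sfun_mono a h)).

Lemma coface_mono (n : nat) (k : 'I_n.+2) (i j : 'I_n.+1) :
  i <= j -> lift k i <= lift k j.
Proof. by move=> h; rewrite leq_bump2. Qed.

Definition coface (n : nat) (k : 'I_n.+2) : simplex_map n n.+1 :=
  SimplexMap (@coface_mono n k).

Definition simplex_const (m n : nat) (k : 'I_n.+1) : simplex_map m n :=
  @SimplexMap m n (fun=> k) (fun i j _ => leqnn k).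

Record sset := SSet {
  cell :> nat -> Type;
  act : forall m n, simplex_map m n -> cell n -> cell m;
  act_id : forall n (x : cell n), act (simplex_id n) x = x;
  act_comp : forall l m n (b : simplex_map m n) (a : simplex_map l m) (x : cell n),
    act (simplex_comp b a) x = act a (act b x)
}.
Arguments act {s m n} _ _.

Record smap (X Y : sset) := SMap {
  sapp :> forall n, X n -> Y n;
  sapp_act : forall m n (a : simplex_map m n) (x : X n),
    sapp (act a x) = act a (sapp x)
}.
Arguments sapp {X Y} _ {n} _.

Lemma smap_eq (X Y : sset) (f g : smap X Y) :
  (forall n (x : X n), f n x = g n x) -> f = g.
Proof.
case: f g => [f nf] [g ng] /= e.
have {}e : f = g by apply functional_extensionality_dep => n; apply: funext.
by subst g; rewrite (Prop_irrelevance nf ng).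
Qed.

Definition smap_comp (X Y Z : sset) (g : smap Y Z) (f : smap X Y) : smap X Z.
Proof.
refine (@SMap X Z (fun n x => g n (f n x)) _).
by move=> m n a x; rewrite !sapp_act.
Defined.

Definition simplex (n : nat) : sset.
Proof.
refine (@SSet (simplex_map^~ n) (fun l m a b => simplex_comp b a) _ _).
- by move=> m x; apply: simplex_map_eq.
- by move=> k l m b a x; apply: simplex_map_eq.
Defined.

Definition sprod (X Y : sset) : sset.
Proof.
refine (@SSet (fun n => X n * Y n)%type
  (fun m n a p => (act a p.1, act a p.2)) _ _).
- by move=> n [x y]; rewrite /= !act_id.
- by move=> l m n b a [x y]; rewrite /= !act_comp.
Defined.

(** The internal hom [Y ^ X], with [(Y ^ X)_n = sSet(X * Delta^n, Y)]. *)
Section InternalHom.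
Variables Y X : sset.

Definition sexp_act (m n : nat) (a : simplex_map m n)
    (u : smap (sprod X (simplex n)) Y) : smap (sprod X (simplex m)) Y.
Proof.
refine (@SMap (sprod X (simplex m)) Y (fun l p => u l (p.1, simplex_comp a p.2)) _).
move=> k l b [x c]; rewrite -sapp_act /=.
by congr (u k (_, _)); apply: simplex_map_eq.
Defined.

Definition sexp : sset.
Proof.
refine (@SSet (fun n => smap (sprod X (simplex n)) Y) sexp_act _ _).
- move=> n u; apply: smap_eq => l [x c] /=.
  by congr (u l (_, _)); apply: simplex_map_eq.
- move=> l m n b a u; apply: smap_eq => k [x c] /=.
  by congr (u k (_, _)); apply: simplex_map_eq.
Defined.

End InternalHom.

Definition sexp_post (Y Z : sset) (f : smap Y Z) (X : sset) :
  smap (sexp Y X) (sexp Z X).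
Proof.
refine (@SMap (sexp Y X) (sexp Z X) (fun n u => smap_comp f u) _).
by move=> m n a u; apply: smap_eq.
Defined.

Lemma sexp_post_comp (Y Z W : sset) (g : smap Z W) (f : smap Y Z) (X : sset) :
  sexp_post (smap_comp g f) X = smap_comp (sexp_post g X) (sexp_post f X).
Proof. by apply: smap_eq => n u; apply: smap_eq. Qed.

Section Pullback.
Variables (B C A : sset) (f : smap B A) (g : smap C A).

Definition spullback_cell (n : nat) := {p : B n * C n | f n p.1 = g n p.2}.

Lemma spullback_act_proof (m n : nat) (a : simplex_map m n) (p : spullback_cell n) :
  f m (act a (sval p).1) = g m (act a (sval p).2).
Proof. by rewrite !sapp_act (svalP p). Qed.

Definition spullback_act (m n : nat) (a : simplex_map m n) (p : spullback_cell n) :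
    spullback_cell m :=
  exist _ (act a (sval p).1, act a (sval p).2) (spullback_act_proof a p).

Definition spullback : sset.
Proof.
refine (@SSet spullback_cell spullback_act _ _).
- by move=> n [[x y] e]; apply: sval_eq; rewrite /= !act_id.
- by move=> l m n b a [[x y] e]; apply: sval_eq; rewrite /= !act_comp.
Defined.

Definition spullback_fst : smap spullback B :=
  @SMap spullback B (fun n p => (sval p).1) (fun m n a p => erefl).

Definition spullback_snd : smap spullback C :=
  @SMap spullback C (fun n p => (sval p).2) (fun m n a p => erefl).

Lemma spullback_comm : smap_comp f spullback_fst = smap_comp g spullback_snd.
Proof. by apply: smap_eq => n [p e]. Qed.

End Pullback.

(** [horn n k] is the union of the faces of [Delta^n] that contain the vertex
    [k]: its simplices are those [a] whose image, together with [k], is not all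
    of [n]. *)
Definition in_horn (n : nat) (k : 'I_n.+1) (m : nat) (a : simplex_map m n) : Prop :=
  exists i : 'I_n.+1, i != k /\ forall j, a j != i.

Definition horn_cell (n : nat) (k : 'I_n.+1) (m : nat) :=
  {a : simplex_map m n | in_horn k a}.

Lemma horn_act_proof (n : nat) (k : 'I_n.+1) (l m : nat) (b : simplex_map l m)
    (a : horn_cell k m) : in_horn k (simplex_comp (sval a) b).
Proof. by case: a => a [i [ik ai]]; exists i; split=> // j; apply: ai. Qed.

Definition horn (n : nat) (k : 'I_n.+1) : sset.
Proof.
refine (@SSet (horn_cell k)
  (fun l m b a => exist _ (simplex_comp (sval a) b) (horn_act_proof b a)) _ _).
- by move=> m [a h]; apply: sval_eq; apply: simplex_map_eq.
- by move=> l m p c b [a h]; apply: sval_eq; apply: simplex_map_eq.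
Defined.

Definition horn_incl (n : nat) (k : 'I_n.+1) : smap (horn k) (simplex n) :=
  @SMap (horn k) (simplex n) (fun m a => sval a) (fun l m b a => erefl).

Definition rlp (U V X Y : sset) (i : smap U V) (p : smap X Y) : Prop :=
  forall (u : smap U X) (v : smap V Y), smap_comp p u = smap_comp v i ->
  exists w : smap V X, smap_comp w i = u /\ smap_comp p w = v.

Definition quasi_category (X : sset) : Prop :=
  forall (n : nat) (k : 'I_n.+1), 2 <= n -> 0 < k < n ->
  forall u : smap (horn k) X,
  exists w : smap (simplex n) X, smap_comp w (horn_incl k) = u.

Definition ordinal_cat (n : nat) : category.
Proof.
refine (@Category 'I_n.+1 (fun i j => i <= j) (fun i => leqnn i)
  (fun i j k h g => leq_trans g h) _ _ _); by move=> *; apply: bool_irrelevance.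
Defined.

Definition ordinal_functor (m n : nat) (a : simplex_map m n) :
  functor (ordinal_cat m) (ordinal_cat n).
Proof.
refine (@Functor (ordinal_cat m) (ordinal_cat n) a (fun i j h => sfun_mono a h) _ _);
by move=> *; apply: bool_irrelevance.
Defined.

Definition nerve (C : category) : sset.
Proof.
refine (@SSet (fun n => functor (ordinal_cat n) C)
  (fun m n a F => fcomp F (ordinal_functor a)) _ _).
- by move=> n F; apply: functor_eq => i j h.
- by move=> l m n b a F; apply: functor_eq => i j h.
Defined.

Definition nerve_map (C D : category) (F : functor C D) : smap (nerve C) (nerve D).
Proof.
refine (@SMap (nerve C) (nerve D) (fun n G => fcomp F G) _).
by move=> m n a G; apply: functor_eq => i j h.
Defined.

Definition const_functor (C D : category) (d : D) : functor C D.
Proof.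
refine (@Functor C D (fun=> d) (fun a b _ => idm d) _ _) => //.
by move=> *; rewrite mcomp_idl.
Defined.

Definition nerve_point (C : category) (c : C) : smap (simplex 0) (nerve C).
Proof.
refine (@SMap (simplex 0) (nerve C) (fun n _ => const_functor (ordinal_cat n) c) _).
by move=> m n a x; apply: functor_eq.
Defined.

Definition walking_iso : category.
Proof.
refine (@Category bool (fun _ _ => unit) (fun=> tt) (fun _ _ _ _ _ => tt) _ _ _) => //;
by move=> a b [].
Defined.

(** The two endpoints of the nerve of [walking_iso] are exchanged by an
    automorphism, so the choice of [false] below is immaterial. *)
Definition isofibration (X Y : sset) (p : smap X Y) : Prop :=
  [/\ quasi_category X, quasi_category Y,
      (forall (n : nat) (k : 'I_n.+1), 2 <= n -> 0 < k < n -> rlp (horn_incl k) p)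
    & rlp (nerve_point (false : walking_iso)) p].

(** [h X] is the category freely generated by the vertices and edges of [X],
    subject to [degenerate edge = identity] and [d1 s = d0 s o d2 s] for every
    2-simplex [s]. *)
Section FundamentalCategory.
Variable X : sset.

Definition edge (x y : X 0) :=
  {e : X 1 | act (simplex_const 0 ord0) e = x /\ act (simplex_const 0 ord_max) e = y}.

Lemma degenerate_edge_proof (x : X 0) :
  let e := act (simplex_const 1 (ord0 : 'I_1)) x in
  act (simplex_const 0 ord0) e = x /\ act (simplex_const 0 ord_max) e = x.
Proof.
by split; rewrite -act_comp -[RHS]act_id; congr (act _ x);
  apply: simplex_map_eq => i; apply: val_inj; case: i => -[].
Qed.

Definition degenerate_edge (x : X 0) : edge x x :=
  exist _ (act (simplex_const 1 ord0) x) (degenerate_edge_proof x).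

Inductive edge_path : X 0 -> X 0 -> Type :=
| enil x : edge_path x x
| econs x y z : edge x y -> edge_path y z -> edge_path x z.

Fixpoint ecat x y z (p : edge_path x y) : edge_path y z -> edge_path x z :=
  match p in edge_path x y return edge_path y z -> edge_path x z with
  | enil _ => id
  | econs _ _ _ e p' => fun q => econs e (ecat p' q)
  end.

Lemma ecat_nil x y (p : edge_path x y) : ecat p (enil y) = p.
Proof. by elim: p => //= {}x {}y z e p ->. Qed.

Lemma ecatA x y z t (p : edge_path x y) (q : edge_path y z) (r : edge_path z t) :
  ecat p (ecat q r) = ecat (ecat p q) r.
Proof. by elim: p q r => //= {}x {}y w e p IH q r; rewrite IH. Qed.

Definition eone x y (e : edge x y) : edge_path x y := econs e (enil y).

Inductive path_rel : forall x y, edge_path x y -> edge_path x y -> Prop :=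
| path_rel_refl x y (p : edge_path x y) : path_rel p p
| path_rel_sym x y (p q : edge_path x y) : path_rel p q -> path_rel q p
| path_rel_trans x y (p q r : edge_path x y) :
    path_rel p q -> path_rel q r -> path_rel p r
| path_rel_cat x y z (p p' : edge_path x y) (q q' : edge_path y z) :
    path_rel p p' -> path_rel q q' -> path_rel (ecat p q) (ecat p' q')
| path_rel_degenerate x : path_rel (eone (degenerate_edge x)) (enil x)
| path_rel_triangle x y z (u : edge x y) (v : edge y z) (w : edge x z) (s : X 2) :
    act (coface ord_max) s = sval u -> act (coface ord0) s = sval v ->
    act (coface (inord 1)) s = sval w ->
    path_rel (ecat (eone u) (eone v)) (eone w).

Definition path_eqv (x y : X 0) : rel {classic edge_path x y} :=
  fun p q => `[< path_rel p q >].

Lemma path_eqv_refl x y : reflexive (@path_eqv x y).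
Proof. by move=> p; apply/asboolP; apply: path_rel_refl. Qed.

Lemma path_eqv_sym x y : symmetric (@path_eqv x y).
Proof. by move=> p q; apply/asboolP/asboolP; apply: path_rel_sym. Qed.

Lemma path_eqv_trans x y : transitive (@path_eqv x y).
Proof.
by move=> q p r /asboolP pq /asboolP qr; apply/asboolP; apply: path_rel_trans qr.
Qed.

Canonical path_equiv (x y : X 0) :=
  EquivRel (@path_eqv x y) (@path_eqv_refl x y) (@path_eqv_sym x y)
    (@path_eqv_trans x y).

Definition hhom (x y : X 0) : Type := {eq_quot path_equiv x y}.

Definition hclass x y (p : edge_path x y) : hhom x y :=
  \pi_{eq_quot path_equiv x y} p.

Definition hrepr x y (u : hhom x y) : edge_path x y := repr u.

Lemma hclassP x y (p q : edge_path x y) : hclass p = hclass q <-> path_rel p q.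
Proof. by split=> [/eqmodP/asboolP | pq]; last apply/eqmodP/asboolP. Qed.

Lemma hreprK x y (u : hhom x y) : hclass (hrepr u) = u.
Proof. exact: reprK. Qed.

Lemma hrepr_class x y (p : edge_path x y) : path_rel (hrepr (hclass p)) p.
Proof. by apply/hclassP; rewrite hreprK. Qed.

Definition hcomp x y z (v : hhom y z) (u : hhom x y) : hhom x z :=
  hclass (ecat (hrepr u) (hrepr v)).

Lemma hcomp_class x y z (q : edge_path y z) (p : edge_path x y) :
  hcomp (hclass q) (hclass p) = hclass (ecat p q).
Proof. by apply/hclassP; apply: path_rel_cat; apply: hrepr_class. Qed.

Definition hcat : category.
Proof.
refine (@Category (X 0) hhom (fun x => hclass (enil x)) hcomp _ _ _).
- by move=> x y u; rewrite -(hreprK u) hcomp_class ecat_nil.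
- by move=> x y u; rewrite -(hreprK u) hcomp_class.
- move=> x y z t w v u.
  by rewrite -(hreprK u) -(hreprK v) -(hreprK w) !hcomp_class ecatA.
Defined.

Lemma arr_edge (x y x' y' : X 0) (e : edge x y) (e' : edge x' y') :
  sval e = sval e' ->
  @arr hcat x y (hclass (eone e)) = @arr hcat x' y' (hclass (eone e')).
Proof.
case: e e' => e [ex ey] [e' [ex' ey']] /= ee'; subst.
by congr (@arr hcat _ _ (hclass (eone _))); apply: sval_eq.
Qed.

End FundamentalCategory.

Section FundamentalFunctor.
Variables (X Y : sset) (f : smap X Y).

Lemma map_edge_proof (x y : X 0) (e : edge x y) :
  act (simplex_const 0 ord0) (f 1 (sval e)) = f 0 x /\
  act (simplex_const 0 ord_max) (f 1 (sval e)) = f 0 y.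
Proof. by case: e => e /= [ex ey]; rewrite -ex -ey !sapp_act. Qed.

Definition map_edge (x y : X 0) (e : edge x y) : edge (f 0 x) (f 0 y) :=
  exist _ (f 1 (sval e)) (map_edge_proof e).

Fixpoint map_path x y (p : edge_path x y) : edge_path (f 0 x) (f 0 y) :=
  match p with
  | enil x => enil (f 0 x)
  | econs _ _ _ e p' => econs (map_edge e) (map_path p')
  end.

Lemma map_path_cat x y z (p : edge_path x y) (q : edge_path y z) :
  map_path (ecat p q) = ecat (map_path p) (map_path q).
Proof. by elim: p q => //= {}x {}y w e p IH q; rewrite IH. Qed.

Lemma map_path_rel x y (p q : edge_path x y) :
  path_rel p q -> path_rel (map_path p) (map_path q).
Proof.
elim=> {x y p q} [x y p | x y p q _ | x y p q r _ + _ | x y z p p' q q' _ hp _ hq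
  | x | x y z u v w s hu hv hw].
- exact: path_rel_refl.
- exact: path_rel_sym.
- exact: path_rel_trans.
- by rewrite !map_path_cat; apply: path_rel_cat.
- rewrite /= (_ : map_edge _ = degenerate_edge (f 0 x)); last first.
    by apply: sval_eq; rewrite /= sapp_act.
  exact: path_rel_degenerate.
- by apply: (@path_rel_triangle _ _ _ _ _ _ _ (f 2 s));
    rewrite -sapp_act /= ?hu ?hv ?hw.
Qed.

Definition hmap : functor (hcat X) (hcat Y).
Proof.
refine (@Functor (hcat X) (hcat Y) (f 0)
  (fun x y u => hclass (map_path (hrepr u))) _ _).
- by move=> x; apply/hclassP; apply: (map_path_rel (hrepr_class (enil x))).
- move=> x y z v u /=; rewrite hcomp_class -map_path_cat; apply/hclassP.
  exact/map_path_rel/hrepr_class.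
Defined.

Lemma hmap_class x y (p : edge_path x y) :
  fmap hmap (hclass p : @hom (hcat X) x y) = hclass (map_path p).
Proof. by apply/hclassP/map_path_rel/hrepr_class. Qed.

End FundamentalFunctor.

Lemma hmap_comp (X Y Z : sset) (g : smap Y Z) (f : smap X Y) :
  hmap (smap_comp g f) = fcomp (hmap g) (hmap f).
Proof.
apply: functor_eq => x y u; rewrite -[u]hreprK hmap_class.
rewrite (_ : fmap (fcomp _ _) _ = fmap (hmap g) (fmap (hmap f)
  (hclass (hrepr u) : @hom (hcat X) x y))) // hmap_class.
rewrite (hmap_class g (map_path f (hrepr u))).
congr (arr (C := hcat Z) (hclass _)).
by elim: (hrepr u) => //= {u}x {}y z e p ->; congr (econs _ _); apply: sval_eq.
Qed.

Section Unit.
Variables (X : sset) (n : nat) (s : X n).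

Definition vertex (i : 'I_n.+1) : X 0 := act (simplex_const 0 i) s.

Lemma segment_mono (i j : 'I_n.+1) (ij : i <= j) (k l : 'I_2) :
  k <= l -> (if k == ord0 then i else j) <= (if l == ord0 then i else j).
Proof. by case: k l => [[|[|//]] ?] [[|[|//]] ?]. Qed.

Definition segment (i j : 'I_n.+1) (ij : i <= j) : simplex_map 1 n :=
  @SimplexMap 1 n (fun k => if k == ord0 then i else j) (segment_mono ij).

Lemma edge_of_proof (i j : 'I_n.+1) (ij : i <= j) :
  let e := act (segment ij) s in
  act (simplex_const 0 ord0) e = vertex i /\ act (simplex_const 0 ord_max) e = vertex j.
Proof. by split; rewrite -act_comp; congr (act _ s); apply: simplex_map_eq. Qed.

Definition edge_of (i j : 'I_n.+1) (ij : i <= j) : edge (vertex i) (vertex j) :=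
  exist _ (act (segment ij) s) (edge_of_proof ij).

Lemma triangle_mono (i j k : 'I_n.+1) (ij : i <= j) (jk : j <= k) (a b : 'I_3) :
  let t (c : 'I_3) := if val c is c'.+1 then if c' is _.+1 then k else j else i in
  a <= b -> t a <= t b.
Proof.
have ik := leq_trans ij jk.
by case: a b => [[|[|[|//]]] ?] [[|[|[|//]]] ?].
Qed.

Definition triangle (i j k : 'I_n.+1) (ij : i <= j) (jk : j <= k) :
    simplex_map 2 n :=
  @SimplexMap 2 n
    (fun c : 'I_3 => if val c is c'.+1 then if c' is _.+1 then k else j else i)
    (triangle_mono ij jk).

Definition hunit_cell : functor (ordinal_cat n) (hcat X).
Proof.
refine (@Functor (ordinal_cat n) (hcat X) vertex
  (fun i j ij => hclass (eone (edge_of ij))) _ _).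
- move=> i; apply/hclassP.
  rewrite (_ : edge_of _ = degenerate_edge (vertex i)).
    exact: path_rel_degenerate.
  apply: sval_eq; rewrite /= -act_comp; congr (act _ s).
  by apply: simplex_map_eq => k /=; case: ifP.
- move=> i j k jk ij; rewrite /= hcomp_class; apply/hclassP/path_rel_sym.
  apply: (@path_rel_triangle _ _ _ _ _ _ _ (act (triangle ij jk) s));
    rewrite /= -act_comp; congr (act _ s); apply: simplex_map_eq;
    by case=> [[|[|//]] ?] /=; rewrite ?/bump ?inordK.
Defined.

End Unit.

Definition hunit (X : sset) : smap X (nerve (hcat X)).
Proof.
refine (@SMap X (nerve (hcat X)) (@hunit_cell X) _).
move=> m n a x; apply: functor_eq => i j ij /=.
have ev k : vertex (act a x) k = vertex x (a k).
  by rewrite /vertex -act_comp; congr (act _ x); apply: simplex_map_eq.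
apply: arr_edge => //=; rewrite -act_comp; congr (act _ x).
by apply: simplex_map_eq => k /=; case: ifP.
Defined.

Section Transpose.
Variables (X : sset) (C : category) (f : smap X (nerve C)).

Definition tr_obj (x : X 0) : C := f 0 x ord0.

Definition step : @hom (ordinal_cat 1) ord0 ord_max := isT.

Lemma tr_src (x y : X 0) (e : edge x y) : f 1 (sval e) ord0 = tr_obj x.
Proof. by case: e => e /= [<- _]; rewrite /tr_obj sapp_act. Qed.

Lemma tr_tgt (x y : X 0) (e : edge x y) : f 1 (sval e) ord_max = tr_obj y.
Proof. by case: e => e /= [_ <-]; rewrite /tr_obj sapp_act. Qed.

Definition tr_edge (x y : X 0) (e : edge x y) : hom (tr_obj x) (tr_obj y) :=
  eq_rect _ (hom (tr_obj x))
    (eq_rect _ (hom^~ _) (fmap (f 1 (sval e)) step) _ (tr_src e)) _ (tr_tgt e).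

Lemma arr_tr_edge (x y : X 0) (e : edge x y) :
  arr (tr_edge e) = arr (fmap (f 1 (sval e)) step).
Proof. by rewrite /tr_edge; case: _ / (tr_tgt e); case: _ / (tr_src e). Qed.

Lemma arr_face (n : nat) (s : X n) (i j : 'I_n.+1) (ij : i <= j) x y (e : edge x y) :
  sval e = act (segment ij) s ->
  arr (tr_edge e) = arr (fmap (f n s) (ij : @hom (ordinal_cat n) i j)).
Proof.
move=> es; rewrite arr_tr_edge es sapp_act.
apply: (congr1 (fun h : @hom (ordinal_cat n) i j => arr (fmap (f n s) h))).
exact: bool_irrelevance.
Qed.

Fixpoint tr_path x y (p : edge_path x y) : hom (tr_obj x) (tr_obj y) :=
  match p with
  | enil x => idm (tr_obj x)
  | econs _ _ _ e p' => mcomp (tr_path p') (tr_edge e)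
  end.

Lemma tr_path_cat x y z (p : edge_path x y) (q : edge_path y z) :
  tr_path (ecat p q) = mcomp (tr_path q) (tr_path p).
Proof.
elim: p q => [{}x | {}x {}y w e p IH] q /=; first by rewrite mcomp_idr.
by rewrite IH mcompA.
Qed.

Lemma tr_path_rel x y (p q : edge_path x y) : path_rel p q -> tr_path p = tr_path q.
Proof.
elim=> {x y p q} //.
- by move=> x y p q r _ -> _ ->.
- by move=> x y z p p' q q' _ hp _ hq; rewrite !tr_path_cat hp hq.
- move=> x; rewrite /= mcomp_idl; apply: arr_inj.
  rewrite (@arr_face 0 x ord0 ord0 (leqnn _)) /=; last first.
    by congr (act _ x); apply: simplex_map_eq => k; rewrite /= if_same.
  by rewrite (bool_irrelevance (leqnn _) (idm (ord0 : ordinal_cat 0))) fmap_id.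
- move=> x y z u v w s hu hv hw; rewrite /= !mcomp_idl; apply: arr_inj.
  pose o1 : 'I_3 := inord 1.
  have o1E : o1 = 1 :> nat by rewrite inordK.
  have h01 : (ord0 : 'I_3) <= o1 by [].
  have h12 : o1 <= (ord_max : 'I_3) by rewrite o1E.
  have h02 : (ord0 : 'I_3) <= (ord_max : 'I_3) by [].
  rewrite (@arr_face 2 s _ _ h02 _ _ w); last first.
    rewrite -hw; congr (act _ s); apply: simplex_map_eq.
    by case=> [[|[|//]] ?]; apply: val_inj; rewrite /= /bump o1E.
  have -> : h02 = mcomp (c0 := ordinal_cat 2) h12 h01 by apply: bool_irrelevance.
  rewrite fmap_comp; apply: arr_mcomp; apply: arr_face.
    rewrite -hv; congr (act _ s); apply: simplex_map_eq.
    by case=> [[|[|//]] ?]; apply: val_inj; rewrite /= /bump ?o1E.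
  rewrite -hu; congr (act _ s); apply: simplex_map_eq.
  by case=> [[|[|//]] ?]; apply: val_inj; rewrite /= /bump ?o1E.
Qed.

Definition transpose : functor (hcat X) C.
Proof.
refine (@Functor (hcat X) C tr_obj (fun x y u => tr_path (hrepr u)) _ _).
- by move=> x; rewrite (tr_path_rel (hrepr_class (enil x))).
- move=> x y z v u /=.
  by rewrite -tr_path_cat; apply/tr_path_rel/hrepr_class.
Defined.

End Transpose.

(** [hunit] is a universal arrow from [X] to the nerve; together with
    [hunit_natural] this says that [h] is left adjoint to the nerve. *)
Theorem hcat_universal (X : sset) (C : category) (f : smap X (nerve C)) :
  exists! F : functor (hcat X) C, smap_comp (nerve_map F) (hunit X) = f.
Proof.
exists (transpose f); split.
  apply: smap_eq => n s; apply: functor_eq => i j ij.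
  rewrite -(arr_face (e := edge_of s ij) f (erefl _)) /=; congr (arr _).
  by rewrite (tr_path_rel f (hrepr_class _)) /= mcomp_idl.
move=> F <-; apply: functor_eq => x y u; rewrite -[u]hreprK /= .
rewrite (tr_path_rel _ (hrepr_class _)).
elim: (hrepr u) => {u x y} [x | x y z e p IH].
  rewrite (_ : hclass _ = idm (x : hcat X)) // fmap_id /= /tr_obj /=.
  have -> // : vertex x ord0 = x.
  by rewrite -[RHS]act_id; congr (act _ x); apply: simplex_map_eq => -[[|//] ?];
    apply: val_inj.
rewrite (_ : hclass (econs e p) = mcomp (hclass p : @hom (hcat X) y z) (hclass (eone e)));
  last by rewrite /= hcomp_class.
rewrite fmap_comp /=; apply: arr_mcomp => //.
rewrite arr_tr_edge /=; apply: arr_fmap; apply: arr_edge => /=.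
rewrite (_ : segment _ = simplex_id 1) ?act_id //.
by apply: simplex_map_eq => -[[|[|//]] ?]; apply: val_inj.
Qed.

Theorem hunit_natural (X Y : sset) (f : smap X Y) :
  smap_comp (nerve_map (hmap f)) (hunit X) = smap_comp (hunit Y) f.
Proof.
apply: smap_eq => n s; apply: functor_eq => i j ij.
rewrite [fmap _ _](hmap_class f (eone (edge_of s ij))) /=.
by apply: arr_edge; rewrite /= sapp_act.
Qed.

(** The hom-category [hom'(X, Y) = h (Y ^ X)]. *)
Definition hom2 (X Y : sset) : category := hcat (sexp Y X).

(** Composition with [f : Y -> Z] is the functor [h (f ^ X)]. *)
Definition hom2_post (X Y Z : sset) (f : smap Y Z) : functor (hom2 X Y) (hom2 X Z) :=
  hmap (sexp_post f X).

Lemma hom2_post_comp (X Y Z W : sset) (g : smap Z W) (f : smap Y Z) :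
  hom2_post X (smap_comp g f) = fcomp (hom2_post X g) (hom2_post X f).
Proof. by rewrite /hom2_post sexp_post_comp hmap_comp. Qed.

Section WeakPullback.
Variables (P B C A : sset) (f : smap B A) (g : smap C A) (p : smap P B) (q : smap P C).
Hypothesis sq : smap_comp f p = smap_comp g q.

Lemma hom2_square (X : sset) :
  fcomp (hom2_post X f) (hom2_post X p) = fcomp (hom2_post X g) (hom2_post X q).
Proof. by rewrite -!hom2_post_comp sq. Qed.

Definition hom2_comparison (X : sset) :
    functor (hom2 X P) (cat_pullback (hom2_post X f) (hom2_post X g)) :=
  cat_pair (hom2_square X).

Definition weak_2_pullback : Prop :=
  forall X : sset, quasi_category X -> smothering (hom2_comparison X).

End WeakPullback.

(* Main.v *)
(** Write [Y ^ X] for the internal hom. The cells of [(B *_A C) ^ X] are the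
    compatible pairs of cells of [B ^ X] and [C ^ X], these are quasi-categories,
    and [g ^ X] is an inner fibration: by a retract argument this reduces to
    lifting inner fibrations against the pushout-products of monomorphisms with
    [Lambda^2_1 -> Delta^2], hence of boundary inclusions with it, which are
    filled one inner horn at a time.

    In the homotopy category of a quasi-category every morphism is the class of
    an edge, and two parallel edges have the same class iff they bound a triangle
    whose last edge is degenerate. Lifting such a triangle along [g ^ X] gives
    fullness. For conservativity, let [(u, v)] be an edge of the pullback with
    both components invertible, and [t] a triangle exhibiting an inverse of [u].
    Its image in [A ^ X] lifts to a triangle starting with [v], because [v] is
    invertible (Joyal's special outer horns, in dimension two), so [(u, v)] has
    a right inverse whose components are again invertible. *)

From mathcomp Require Import all_boot boolp zify.
From mathcomp Require classical_sets.
Require Import Defs.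

Set Implicit Arguments.
Unset Strict Implicit.
Unset Printing Implicit Defensive.

(** * Horns in terms of faces *)

Lemma face_lt (n i : nat) (j : 'I_n.+1) : bump i j < n.+2.
Proof. by rewrite /bump; case: j => j /=; lia. Qed.

Lemma face_mono (n i : nat) (j k : 'I_n.+1) :
  j <= k -> Ordinal (face_lt i j) <= Ordinal (face_lt i k).
Proof. by rewrite /= leq_bump2. Qed.

(** For [i > n.+1] this is not a coface: the image is then the initial segment
    of length [n.+1]. *)
Definition face (n i : nat) : simplex_map n n.+1 := SimplexMap (@face_mono n i).

Definition bd (X : sset) (n i : nat) (x : X n.+1) : X n := act (face n i) x.

Lemma sapp_bd (X Y : sset) (f : smap X Y) (n i : nat) (x : X n.+1) :
  f n (bd i x) = bd i (f n.+1 x).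
Proof. exact: sapp_act. Qed.

Lemma face_face (n i j : nat) : i < j ->
  simplex_comp (face n.+1 j) (face n i) = simplex_comp (face n.+1 i) (face n j.-1).
Proof.
by move=> ij; apply: simplex_map_eq => l; apply: val_inj; rewrite /= /bump; lia.
Qed.

Lemma bd_bd (X : sset) (n i j : nat) (x : X n.+2) : i < j ->
  bd i (bd j x) = bd j.-1 (bd i x).
Proof. by move=> ij; rewrite /bd -!act_comp face_face. Qed.

Lemma face_inj (m n i : nat) (a b : simplex_map m n) :
  simplex_comp (face n i) a = simplex_comp (face n i) b -> a = b.
Proof.
move=> e; apply: simplex_map_eq => j; apply: val_inj; apply: (can_inj (bumpK i)).
exact: (congr1 (fun c : simplex_map m n.+1 => val (c j)) e).
Qed.

Lemma face_factor (m n i : nat) (a : simplex_map m n.+1) : i <= n.+1 ->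
  (forall j, a j != i :> nat) -> exists b, a = simplex_comp (face n i) b.
Proof.
move=> lein ai.
have lt j : unbump i (a j) < n.+1.
  by have := ltn_ord (a j); move: (ai j); rewrite /unbump; lia.
have mono (j k : 'I_m.+1) : j <= k -> Ordinal (lt j) <= Ordinal (lt k).
  by move/(sfun_mono a); rewrite /= /unbump; lia.
exists (SimplexMap mono); apply: simplex_map_eq => j; apply: val_inj.
by rewrite /= unbumpK // inE ai.
Qed.

Lemma face_neq (m n i : nat) (a : simplex_map m n) j :
  simplex_comp (face n i) a j != i :> nat.
Proof. by rewrite /= eq_sym neq_bump. Qed.

(** The simplicial identities that a family of faces must satisfy to glue to a map out of
    $\Lambda^{n+2}_k$. *)
Definition compatible (X : sset) (n k : nat) (x : nat -> X n.+1) : Prop :=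
  forall i j, i < j -> j <= n.+2 -> i != k -> j != k -> bd i (x j) = bd j.-1 (x i).

(** A simplex lying in two faces lies in their intersection, where [compatible] applies; within a
    single face [face_inj] is enough. *)
Lemma compatible_act (X : sset) (n k : nat) (x : nat -> X n.+1) :
  compatible k x -> forall m (a b : simplex_map m n.+1) i j,
  i <= n.+2 -> j <= n.+2 -> i != k -> j != k ->
  simplex_comp (face n.+1 i) a = simplex_comp (face n.+1 j) b ->
  act a (x i) = act b (x j).
Proof.
move=> cx m.
suff H (a b : simplex_map m n.+1) i j : i < j -> j <= n.+2 -> i != k -> j != k ->
    simplex_comp (face n.+1 i) a = simplex_comp (face n.+1 j) b ->
    act a (x i) = act b (x j).
  move=> a b i j lei lej ik jk e; case: (ltngtP i j) => [ij|ji|ij].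
  - exact: H.
  - by apply/esym/H.
  - by subst j; rewrite (face_inj e).
move=> ij lej ik jk e.
have [||c bE] := @face_factor m n i b; first by lia.
  move=> l; apply/negP => /eqP bl.
  have := face_neq i a l; rewrite e /= bl /bump; lia.
have -> : a = simplex_comp (face n j.-1) c.
  apply: (@face_inj _ _ i); rewrite e bE.
  exact: (congr1 (fun d => simplex_comp d c) (face_face n ij)).
by rewrite bE !act_comp; congr (act c _); apply/esym/cx.
Qed.

(** Right lifting property against [Lambda^{n+2}_k -> Delta^{n+2}]; the value
    [x k] and the values [x i] with [i > n+2] are irrelevant. *)
Definition fillable (X Y : sset) (p : smap X Y) (n k : nat) : Prop :=
  forall (x : nat -> X n.+1) (y : Y n.+2), compatible k x ->
  (forall i, i <= n.+2 -> i != k -> p n.+1 (x i) = bd i y) ->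
  exists z : X n.+2, p n.+2 z = y /\ forall i, i <= n.+2 -> i != k -> bd i z = x i.

Definition inner_fibration (X Y : sset) (p : smap X Y) : Prop :=
  forall n k, 0 < k < n.+2 -> fillable p n k.

Definition yoneda (X : sset) (n : nat) (x : X n) : smap (simplex n) X.
Proof.
by refine (@SMap (simplex n) X (fun m a => act a x) _) => l m b a; apply: act_comp.
Defined.

(** Each simplex of the horn gets its value from a chosen face containing it; by [compatible_act]
    the choice does not matter, whence naturality. *)
Lemma rlp_fillable (X Y : sset) (p : smap X Y) (n : nat) (k : 'I_n.+3) :
  rlp (horn_incl k) p -> fillable p n k.
Proof.
move=> lift x y cx pxy.
have fac m (a : horn_cell k m) : {ib : nat * simplex_map m n.+1 |
    [/\ ib.1 <= n.+2, ib.1 != k & sval a = simplex_comp (face n.+1 ib.1) ib.2]}.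
  apply: cid; case: a => a [i [ik ai]].
  have [||b aE] := @face_factor m n.+1 i a; first by rewrite -ltnS ltn_ord.
    by move=> j; apply: contra (ai j) => /eqP e; apply/eqP/val_inj.
  by exists (val i, b); rewrite /= -ltnS ltn_ord.
pose h m (a : horn k m) : X m := act (sval (fac m a)).2 (x (sval (fac m a)).1).
have hE m (a : horn k m) i b : i <= n.+2 -> i != k ->
    sval a = simplex_comp (face n.+1 i) b -> h m a = act b (x i).
  move=> lei ik aE; rewrite /h; case: (fac m a) => -[j c] /= [lej jk e].
  by apply: (compatible_act cx); rewrite // -e -aE.
have hnat l m (b : simplex_map l m) (a : horn k m) : h l (act b a) = act b (h m a).
  rewrite {2}/h; case: (fac m a) => -[j c] /= [lej jk e].
  rewrite (hE _ _ j (simplex_comp c b)) ?act_comp //= e.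
  exact: simplex_map_eq.
have [] := lift (SMap hnat) (yoneda y).
  apply: smap_eq => m a /=; rewrite /h; case: (fac m a) => -[j c] /= [lej jk e].
  by rewrite sapp_act pxy // e act_comp.
move=> w [wh wy]; exists (w _ (simplex_id n.+2)); split.
  by rewrite [LHS](congr1 (fun u : smap (simplex n.+2) Y => u _ (simplex_id n.+2)) wy) /= act_id.
move=> i lei ik; rewrite /bd -sapp_act.
have hi : in_horn k (simplex_comp (simplex_id n.+2) (face n.+1 i)).
  exists (Ordinal (lei : i < n.+3)); split; first exact: ik.
  by move=> j; apply: contra (neq_bump i j) => /eqP/(congr1 val)/= ->.
rewrite [LHS](congr1 (fun u : smap (horn k) X => u _ (exist _ _ hi : horn k n.+1)) wh) /=.
rewrite (hE _ _ i (simplex_id _)) ?act_id //.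
Qed.

(** * Partial lifts *)

Section PartialLifts.
Variables (T X Y : sset) (p : smap X Y) (v : smap T Y).

Definition prel := forall n, T n -> X n -> Prop.

Definition dom (G : prel) (n : nat) (t : T n) : Prop := exists x, G n t x.

(** A partial lift of [v] along [p], as the graph of a simplicial map defined
    on a simplicial subset of [T]. *)
Record plift (G : prel) : Prop := PLift {
  plift_act : forall m n (a : simplex_map m n) t x, G n t x -> G m (act a t) (act a x);
  plift_fun : forall n t x x', G n t x -> G n t x' -> x = x';
  plift_over : forall n t x, G n t x -> p n x = v n t
}.

Lemma dom_act (G : prel) m n (a : simplex_map m n) (t : T n) :
  plift G -> dom G t -> dom G (act a t).
Proof. by move=> lG [x Gx]; exists (act a x); apply: plift_act. Qed.

(** [R] carries the invariant of the Zorn argument below: the domain may only grow by blocks closed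
    under [R]. *)
Definition closed_dom (D : forall n, T n -> Prop)
    (R : forall m n, T m -> T n -> Prop) : Prop :=
  forall m n (t : T m) (t' : T n), R m n t t' -> D m t -> D n t'.

Variable R : forall m n, T m -> T n -> Prop.

(** A proper extension of [G] by gluing in [Q] along the part that [s] sends into the domain of [G];
    [s] has to be injective only outside that part. *)
Definition attachable (G : prel) : Prop :=
  exists (Q : sset) (s : smap Q T) (w : smap Q X),
  [/\ forall n (q : Q n), p n (w n q) = v n (s n q),
      forall n (q : Q n) x, G n (s n q) x -> x = w n q,
      forall n (q q' : Q n), s n q = s n q' -> dom G (s n q) \/ q = q',
      closed_dom (fun n t => dom G t \/ exists q : Q n, t = s n q) R
    & exists n (q : Q n), ~ dom G (s n q)].

(** Zorn's lemma for partial lifts that extend [G0] and have closed domain: a maximal one that is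
    not total would be [attachable]. *)
Lemma total_lift (G0 : prel) : plift G0 -> closed_dom (dom G0) R ->
  (forall G, plift G -> closed_dom (dom G) R ->
     (forall n t x, G0 n t x -> G n t x) ->
     forall n (t : T n), ~ dom G t -> attachable G) ->
  exists w : smap T X, (forall n (t : T n), p n (w n t) = v n t) /\
    forall n t x, G0 n t x -> w n t = x.
Proof.
move=> lG0 cG0 step.
pose U := {G : prel | [/\ plift G, closed_dom (dom G) R &
  forall n t x, G0 n t x -> G n t x]}.
pose le (G H : U) := `[< forall n t x, sval G n t x -> sval H n t x >].
have [||||[G [lG cG G0G]] Gmax] := @classical_sets.Zorn U le.
- by move=> G; apply/asboolP.
- by move=> G H K /asboolP GH /asboolP HK; apply/asboolP => n t x /GH/HK.
- move=> G H /asboolP GH /asboolP HG; apply: sval_eq.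
  apply functional_extensionality_dep => n; apply: funext => t; apply: funext => x.
  by apply/propext; split=> [/GH|/HG].
(* [G0] is added to the union so that the bound of the empty chain extends it too. *)
- move=> F totF; pose G n t x := G0 n t x \/ exists2 H, F H & sval H n t x.
  have ub H : F H -> forall n t x, sval H n t x -> G n t x by right; exists H.
  have GE n t x x' : G n t x -> G n t x' -> (G0 n t x /\ G0 n t x') \/
      exists2 H, F H & sval H n t x /\ sval H n t x'.
    case=> [g|[H FH g]] [g'|[H' FH' g']]; first by left.
    - by right; exists H' => //; case: (svalP H') => _ _ h; split=> //; apply: h.
    - by right; exists H => //; case: (svalP H) => _ _ h; split=> //; apply: h.
    - right; case: (totF _ _ FH FH') => /asboolP h.
        by exists H' => //; split=> //; apply: h.
      by exists H => //; split=> //; apply: h.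
  have UG : [/\ plift G, closed_dom (dom G) R & forall n t x, G0 n t x -> G n t x].
    split; last by left.
    + split=> [m n a t x [g|[H FH g]]|n t x x' g g'|n t x [g|[H FH g]]].
      * by left; apply: plift_act.
      * by right; exists H => //; case: (svalP H) => lH _ _; apply: plift_act.
      * case: (GE _ _ _ _ g g') => [[]|[H FH []]]; first exact: plift_fun.
        by case: (svalP H) => lH _ _; apply: plift_fun.
      * exact: plift_over g.
      * by case: (svalP H) => lH _ _; apply: plift_over g.
    + move=> m n t t' tt' [x [g|[H FH g]]].
        by have [|x' g'] := cG0 _ _ _ _ tt'; [exists x|exists x'; left].
      case: (svalP H) => _ cH _.
      by have [|x' g'] := cH _ _ _ _ tt'; [exists x|exists x'; right; exists H].
  by exists (exist _ G UG) => H FH; apply/asboolP; apply: ub.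
have tot n (t : T n) : dom G t.
  apply: contrapT => ndt.
  have [Q [s [w [pw Gw inj cl [m [q0 nq0]]]]]] := step G lG cG G0G n t ndt.
  pose H n t x := G n t x \/ exists q : Q n, t = s n q /\ x = w n q.
  have domH n' (t' : T n') : dom H t' <-> dom G t' \/ exists q : Q n', t' = s n' q.
    split=> [[x [g|[q [-> _]]]]|[[x g]|[q ->]]].
    - by left; exists x.
    - by right; exists q.
    - by exists x; left.
    - by exists (w n' q); right; exists q.
  have UH : [/\ plift H, closed_dom (dom H) R & forall n t x, G0 n t x -> H n t x].
    split; last by move=> n' t' x g; left; apply: (G0G _ _ _ g).
    + split.
      * move=> l n' a t' x [g|[q [-> ->]]]; first by left; apply: plift_act.
        by right; exists (act a q); rewrite !sapp_act.
      * move=> n' t' x x' [g|[q [-> ->]]] [g'|[q' [e ->]]].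
        - exact: plift_fun g g'.
        - by apply: Gw; rewrite -e.
        - by apply/esym/Gw.
        - case: (inj _ _ _ e) => [[x0 g0]|->//].
          by rewrite -(Gw _ _ _ g0); apply: Gw; rewrite -e.
      * by move=> n' t' x [g|[q [-> ->]]]; [apply: plift_over g|].
    + by move=> l n' t1 t2 t12 /domH/(cl _ _ _ _ t12)/domH.
  have GH : le (exist _ G (And3 lG cG G0G)) (exist _ H UH).
    by apply/asboolP => n' t' x; left.
  have /= e := congr1 sval (Gmax _ GH).
  by apply: nq0; exists (w m q0); rewrite -e; right; exists q0.
pose w n t := sval (cid (tot n t)).
have Gw n t : G n t (w n t) by rewrite /w; case: cid.
have wnat m n (a : simplex_map m n) t : w m (act a t) = act a (w n t).
  by apply: (plift_fun lG) (Gw _ _) _; apply: plift_act.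
exists (SMap wnat); split=> [n t|n t x g] /=; first exact: plift_over (Gw n t).
exact: (plift_fun lG) (Gw n t) (G0G _ _ _ g).
Qed.

End PartialLifts.

(** * Boundary inclusions times the inner 2-horn *)

(** Membership of [c] in $\Lambda^2_1$. *)
Definition misses_end (n : nat) (c : simplex_map n 2) : Prop :=
  (forall j, c j != 0 :> nat) \/ (forall j, c j != 2 :> nat).

Lemma misses_end_comp (l n : nat) (c : simplex_map n 2) (a : simplex_map l n) :
  misses_end c -> misses_end (simplex_comp c a).
Proof. by case=> h; [left|right] => j; apply: h. Qed.

Section Prism.
Variable m : nat.

Notation prism := (sprod (simplex m) (simplex 2)).

Definition col (n : nat) (t : prism n) : simplex_map n m := t.1.

Definition row (n : nat) (t : prism n) : simplex_map n 2 := t.2.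

Lemma col_act (l n : nat) (a : simplex_map l n) (t : prism n) j :
  col (act a t) j = col t (a j).
Proof. by []. Qed.

Lemma row_act (l n : nat) (a : simplex_map l n) (t : prism n) j :
  row (act a t) j = row t (a j).
Proof. by []. Qed.

Lemma col_mono (n : nat) (t : prism n) (i j : 'I_n.+1) : i <= j -> (col t) i <= col t j.
Proof. exact: sfun_mono. Qed.

Lemma row_mono (n : nat) (t : prism n) (i j : 'I_n.+1) : i <= j -> (row t) i <= row t j.
Proof. exact: sfun_mono. Qed.

(** The union $\partial\Delta^m\times\Delta^2\cup\Delta^m\times\Lambda^2_1$, the source of the
    pushout-product. *)
Definition prism_rim (n : nat) (t : prism n) : Prop :=
  (exists i : 'I_m.+1, forall j, col t j != i) \/ misses_end (row t).

Lemma prism_rimN (n : nat) (t : prism n) : ~ prism_rim t <->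
  [/\ forall i : 'I_m.+1, exists j, col t j = i, exists j, row t j = 0 :> nat
    & exists j, row t j = 2 :> nat].
Proof.
split=> [nr|[h0 [j0 e0] [j2 e2]] [[i hi]|[h|h]]].
- split.
  + move=> i; apply: contrapT => h; apply: nr; left; exists i => j.
    by apply/negP => /eqP e; apply: h; exists j.
  + apply: contrapT => h; apply: nr; right; left => j.
    by apply/negP => /eqP e; apply: h; exists j.
  + apply: contrapT => h; apply: nr; right; right => j.
    by apply/negP => /eqP e; apply: h; exists j.
- by have [j e] := h0 i; have := hi j; rewrite e eqxx.
- by have := h j0; rewrite e0.
- by have := h j2; rewrite e2.
Qed.

Lemma prism_eq (n : nat) (t t' : prism n) :
  (forall j, col t j = col t' j) -> (forall j, row t j = row t' j) -> t = t'.
Proof.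
case: t t' => [a c] [a' c'] /= ea ec.
by rewrite (simplex_map_eq ea) (simplex_map_eq ec).
Qed.

(** Each vertex of [t'] is sent to its first occurrence in [t]; taking the first one makes the
    choice monotone. *)
Lemma prism_factor (n n' : nat) (t : prism n) (t' : prism n') :
  (forall j', exists j, col t' j' = col t j /\ row t' j' = row t j) ->
  exists b : simplex_map n' n, t' = act b t.
Proof.
move=> im; pose P j' (j : 'I_n.+1) := (col t' j' == col t j) && (row t' j' == row t j).
have hP j' : exists j, P j' j.
  by have [j [e1 e2]] := im j'; exists j; rewrite /P e1 e2 !eqxx.
pose b j' := [arg min_(j < xchoose (hP j') | P j' j) (j : nat)].
have bP j' : P j' (b j') /\ forall j, P j' j -> b j' <= j.
  by rewrite /b; case: arg_minnP => [|j Pj h]; first exact: xchooseP.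
have bmono (j j' : 'I_n'.+1) : j <= j' -> b j <= b j'.
  move=> jj'; case: (leqP (b j) (b j')) => // ltb.
  have [/andP[/eqP ej1 /eqP ej2] minj] := bP j.
  have [/andP[/eqP ej1' /eqP ej2'] minj'] := bP j'.
  suff : b j <= b j' by rewrite leqNgt ltb.
  apply: minj; rewrite /P.
  have h1 := col_mono t' jj'; have h2 := row_mono t' jj'.
  have h3 := col_mono t (ltnW ltb); have h4 := row_mono t (ltnW ltb).
  rewrite -ej1 -ej1' in h3; rewrite -ej2 -ej2' in h4.
  by rewrite -ej1' -ej2'; apply/andP; split; apply/eqP/ord_inj => /=; lia.
exists (SimplexMap bmono); apply: prism_eq => j' /=;
  by have [/andP[/eqP ? /eqP ?] _] := bP j'.
Qed.

(** A simplex outside the rim is paired with the one obtained by adding or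
    removing the vertex [(i, 1)], where [(i, 0)] is its last vertex in row [0];
    [(i, 1)] is an inner vertex, so each pair is attached along an inner horn. *)
Definition prism_pivot (n : nat) (t : prism n) : nat :=
  \max_(j | row t j == 0 :> nat) col t j.

Lemma prism_pivot_ge (n : nat) (t : prism n) j :
  row t j = 0 :> nat -> col t j <= prism_pivot t.
Proof. by move/eqP => h; apply: (leq_bigmax_cond (F := fun j => col t j : nat)). Qed.

Lemma prism_pivot_ex (n : nat) (t : prism n) : ~ prism_rim t ->
  exists j, row t j = 0 :> nat /\ col t j = prism_pivot t :> nat.
Proof.
move/prism_rimN => [_ [j0 /eqP e0] _].
have [|j hj e] := @eq_bigmax_cond _ [pred j | row t j == 0 :> nat] (fun j => col t j : nat).
  by apply/card_gt0P; exists j0.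
by exists j; split; [exact/eqP | rewrite -e; apply: eq_bigl].
Qed.

Lemma prism_pivot_act (l n : nat) (b : simplex_map l n) (t : prism n) :
  prism_pivot (act b t) <= prism_pivot t.
Proof. by apply/bigmax_leqP => j /eqP h; apply: prism_pivot_ge. Qed.

Lemma prism_pivot_comp (l n : nat) (b : simplex_map l n) (t : prism n) :
  (exists j, (row t) (b j) = 0 :> nat /\ (col t) (b j) = prism_pivot t :> nat) ->
  prism_pivot (act b t) = prism_pivot t.
Proof.
move=> [j [h0 h1]]; apply/eqP; rewrite eqn_leq prism_pivot_act /= -h1.
exact: (@prism_pivot_ge _ (act b t)).
Qed.

Definition has_pivot (n : nat) (t : prism n) : Prop :=
  exists j, row t j = 1 :> nat /\ col t j = prism_pivot t :> nat.

(** The last vertex of [t] in row 0 is doubled and the second copy is moved up to row 1. *)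
Lemma prism_insert (n : nat) (t : prism n) : ~ prism_rim t ->
  exists t' : prism n.+1, [/\ exists b : simplex_map n n.+1, t = act b t', has_pivot t'
    & prism_pivot t' = prism_pivot t].
Proof.
move=> nr; have [_ _ [j2 e2]] := (prism_rimN t).1 nr.
have [j1 [ej1 ej1']] := prism_pivot_ex nr.
pose j0 := [arg max_(j > j1 | row t j == 0 :> nat) (j : nat)].
have [e0 max0] : row t j0 = 0 :> nat /\ forall j, row t j = 0 :> nat -> j <= j0.
  rewrite /j0; case: arg_maxnP => [|j /eqP ej h]; first by apply/eqP.
  by split=> // i /eqP/h.
have e0' : col t j0 = prism_pivot t :> nat.
  have := col_mono t (max0 _ ej1); have := prism_pivot_ge e0; lia.
have dlt (j : 'I_n.+2) : j - (j0 < j) < n.+1.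
  by have := ltn_ord j; have := ltn_ord j0; lia.
have dmono (j k : 'I_n.+2) : j <= k -> Ordinal (dlt j) <= Ordinal (dlt k).
  by rewrite /=; lia.
have [dg dgE] : exists dg : simplex_map n.+1 n, forall j, dg j = j - (j0 < j) :> nat.
  by exists (SimplexMap dmono).
(* The [maxn] acts only at [j0.+1], the second copy of [j0]: later vertices are in row 1 or 2
   already. *)
have clt (j : 'I_n.+2) : (if j <= j0 then 0 else maxn 1 ((row t) (dg j))) < 3.
  by case: ifP => // _; have := ltn_ord ((row t) (dg j)); lia.
have cmono (j k : 'I_n.+2) : j <= k -> Ordinal (clt j) <= Ordinal (clt k).
  move=> jk; rewrite /=; case: (leqP j j0) => // ltj.
  have -> : (k <= j0) = false by lia.
  by have := row_mono t (sfun_mono dg jk); lia.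
have [t' [t'c t'r]] : exists t' : prism n.+1,
    (forall j, col t' j = col t (dg j)) /\
    forall j, row t' j = (if j <= j0 then 0 else maxn 1 (row t (dg j))) :> nat.
  by exists (simplex_comp (col t) dg, SimplexMap cmono).
have lt1 : j0.+1 < n.+2 by have := ltn_ord j0; lia.
have dg1 : dg (Ordinal lt1) = j0 by apply: ord_inj; rewrite /= dgE /=; lia.
have lt0 : j0 < n.+2 by lia.
have dg0 : dg (Ordinal lt0) = j0 by apply: ord_inj; rewrite /= dgE /=; lia.
have piv' : prism_pivot t' = prism_pivot t.
  apply/eqP; rewrite eqn_leq -{2}e0'; apply/andP; split.
    apply/bigmax_leqP => j; rewrite t'r t'c -e0'; case: (leqP j j0) => [lej _|ltj].
      by apply: col_mono; rewrite dgE; lia.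
    by have -> : (maxn 1 (row t (dg j)) == 0) = false by lia.
  by rewrite -[in X in X <= _]dg0 -t'c; apply: prism_pivot_ge; rewrite t'r /= leqnn.
exists t'; split=> //.
- exists (face n j0.+1); apply: prism_eq => j.
    by rewrite [RHS]t'c; congr (col t _); apply: ord_inj; rewrite dgE /= /bump; lia.
  apply: ord_inj; rewrite [RHS]t'r.
  have fE : face n j0.+1 j = (j0 < j) + j :> nat by [].
  move: (face _ _ _) fE => f fE.
  have -> : dg f = j by apply: ord_inj; rewrite dgE; lia.
  case: (ltnP j0 j) => h.
    have : row t j != 0 :> nat by apply/negP => /eqP/max0; lia.
    by rewrite ifF; lia.
  by rewrite ifT; [have := row_mono t h; rewrite e0|]; lia.
- by exists (Ordinal lt1); rewrite piv' t'r t'c dg1 e0' /= ltnn e0.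
Qed.

Section Lift.
Variables (X Y : sset) (p : smap X Y) (v : smap prism Y).

(** Closedness under [R] means that a defined simplex outside the rim stays defined when its pivot
    vertex is added. A minimal undefined simplex with a pivot then meets the domain exactly in an
    inner horn. *)
Lemma prism_lift (G0 : prel prism X) : inner_fibration p -> plift p v G0 ->
  (forall n (t : prism n), dom G0 t <-> prism_rim t) ->
  exists w : smap prism X, (forall n (t : prism n), p n (w n t) = v n t) /\
    forall n t x, G0 n t x -> w n t = x.
Proof.
move=> ip lG0 domG0.
pose R n n' (t : prism n) (t' : prism n') := ~ prism_rim t /\
  forall j', (exists j, col t' j' = col t j /\ row t' j' = row t j) \/
    (col t' j' = prism_pivot t :> nat /\ row t' j' = 1 :> nat).
apply: (total_lift (R := R)) => //.
  by move=> n n' t t' [nr _] /domG0.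
move=> G lG cG G0G n t ndt.
have rimD l (s : prism l) : prism_rim s -> dom G s.
  by case/domG0 => x /G0G; exists x.
(* With this rank, deleting a vertex while keeping the pivot goes down, and so does passing to a
   face with a smaller pivot and inserting that pivot. *)
pose P r := `[< exists l (s : prism l),
  [/\ ~ dom G s, has_pivot s & r = l + prism_pivot s] >].
have exP : exists r, P r.
  have [|t' [[b tE] hp _]] := @prism_insert n t; first by move/rimD.
  exists (n.+1 + prism_pivot t'); apply/asboolP; exists n.+1, t'; split=> //.
  by move=> d; apply: ndt; rewrite tE; apply: (dom_act _ lG).
case: (ex_minnP exP) => r /asboolP[N [s [nds hps rE]]] rmin.
have {rE rmin} smin l (s' : prism l) : has_pivot s' ->
    l + prism_pivot s' < N + prism_pivot s -> dom G s'.
  move=> hp' lt; apply: contrapT => nd'.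
  have /rmin : P (l + prism_pivot s') by apply/asboolP; exists l, s'.
  by rewrite rE leqNgt lt.
have nrs : ~ prism_rim s by move/rimD.
have [ontos [j0 ej0] [j2 ej2]] := (prism_rimN s).1 nrs.
have [k [k1 kp]] := hps; have [jp [jp0 jpp]] := prism_pivot_ex nrs.
have ltj0 : j0 < k.
  by rewrite ltnNge; apply/negP => /(row_mono s); rewrite k1 ej0.
have ltj2 : k < j2.
  by rewrite ltnNge; apply/negP => /(row_mono s); rewrite k1 ej2.
have [n' NE] : exists n', N = n'.+2.
  by exists N.-2; have := ltn_ord j2; lia.
subst N.
(* A repeated vertex could be deleted without changing the pivot, and [s] would be a degeneracy of a
   defined simplex of lower rank. *)
have injs (i j : 'I_n'.+3) : col s i = col s j -> row s i = row s j -> i = j.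
  suff H (a b : 'I_n'.+3) : a < b -> col s a = col s b -> row s a = row s b -> False.
    move=> e1 e2; apply: ord_inj; case: (ltngtP i j) => // h.
      by case: (H i j).
    by case: (H j i).
  move=> ab e1 e2; pose s' := act (face n'.+1 b) s.
  have im j' : exists j, col s j' = col s' j /\ row s j' = row s' j.
    have skip (c : 'I_n'.+3) : c != b -> exists j, c = face n'.+1 b j.
      move=> cb; have lt : unbump b c < n'.+2.
        by have := ltn_ord c; have := ltn_ord b; move: cb; rewrite -val_eqE /= /unbump; lia.
      by exists (Ordinal lt); apply: ord_inj; rewrite /= unbumpK.
    case: (eqVneq j' b) => [->|/skip[j1 ->]]; last by exists j1.
    have [|j1 ej] := skip a; first by rewrite -val_eqE /= ltn_eqF.
    by exists j1; rewrite -e1 -e2 ej.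
  have [c cE] := prism_factor im.
  have ps' : prism_pivot s' = prism_pivot s.
    by apply/eqP; rewrite eqn_leq prism_pivot_act {1}cE prism_pivot_act.
  apply: nds; rewrite cE; apply: (dom_act _ lG); apply: smin; last by rewrite ps'; lia.
  by have [j3 [ec er]] := im k; exists j3; rewrite -ec -er ps'.
(* A face with the same pivot still contains the vertex [k] and has lower dimension; a face with a
   smaller pivot lies in a simplex of the dimension of [s] with that pivot. *)
have bdD l : l <= n'.+2 -> l != k -> dom G (bd l s).
  move=> lel lk; apply: contrapT => nd; have nr : ~ prism_rim (bd l s) by move/rimD.
  have : prism_pivot (bd l s) <= prism_pivot s by apply: prism_pivot_act.
  rewrite leq_eqVlt => /predU1P[e|lt].
    apply: nd; apply: smin; last by rewrite e; lia.
    have lt : unbump l k < n'.+2.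
      by have := ltn_ord k; move: lk; rewrite /unbump; lia.
    have ke : face n'.+1 l (Ordinal lt) = k.
      by apply: ord_inj; rewrite /= unbumpK // inE eq_sym.
    exists (Ordinal lt); rewrite e.
    have hc : col s (face n'.+1 l (Ordinal lt)) = prism_pivot s :> nat by rewrite ke.
    by have hr : row s (face n'.+1 l (Ordinal lt)) = 1 :> nat by rewrite ke.
  have [t' [[b tE] hp' pt']] := prism_insert nr.
  apply: nd; rewrite tE; apply: (dom_act _ lG).
  by apply: smin => //; rewrite pt'; lia.
(* If [a] hit every index except possibly [k], adding the pivot vertex to [act a s] would recover
   all vertices of [s], and [s] would be defined. *)
have hits l (a : simplex_map l n'.+2) : dom G (act a s) ->
    exists2 i, i <= n'.+2 /\ i != k & forall j, a j != i :> nat.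
  move=> da; apply: contrapT => na.
  have onto (i : 'I_n'.+3) : i != k -> exists j, a j = i.
    move=> ik; apply: contrapT => nj; apply: na; exists i; first by rewrite -ltnS ltn_ord.
    by move=> j; apply/negP => /eqP/ord_inj e; apply: nj; exists j.
  have [|a0 e0] := onto j0; first by rewrite -val_eqE ltn_eqF.
  have [|a2 e2] := onto j2; first by rewrite -val_eqE gtn_eqF.
  have [|ap ep] := onto jp.
    by apply/negP => /eqP e; move: jp0; rewrite e k1.
  have pa : prism_pivot (act a s) = prism_pivot s.
    by apply: prism_pivot_comp; exists ap; rewrite -/(row _ _) -/(col _ _) ep.
  apply: nds; apply: cG da; split.
    apply/prism_rimN; split; last 2 first.
    - by exists a0; rewrite row_act e0.
    - by exists a2; rewrite row_act e2.
    move=> i; have [j je] := ontos i.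
    case: (eqVneq j k) => [jk|/onto[a1 e1]]; last by exists a1; rewrite col_act e1.
    by exists ap; rewrite col_act ep -je jk; apply: ord_inj; rewrite kp.
  move=> j; case: (eqVneq j k) => [->|/onto[a1 <-]]; [right|left].
    by rewrite pa kp k1.
  by exists a1.
have pick i : exists y, i <= n'.+2 -> i != k -> G n'.+1 (bd i s) y.
  case: (pselect (i <= n'.+2 /\ i != k)) => [[lei ik]|ni].
    by have [y Gy] := bdD i lei ik; exists y.
  (* Any cell will do as the irrelevant value of [x]. *)
  have [y _] : dom G (bd 0 s) by apply: bdD => //; lia.
  by exists y => lei ik; case: ni.
have {pick} [x xG] := choice pick.
have kin : 0 < k < n'.+2 by have := ltn_ord j2; lia.
have [||z [pz zx]] := ip n' k kin x (v _ s).
- move=> i j ij lej ik jk; apply: (plift_fun lG (t := bd i (bd j s))).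
    exact: (plift_act lG (face n' i) (xG _ lej jk)).
  rewrite bd_bd //; apply: (plift_act lG (face n' j.-1) (xG _ _ ik)).
  by apply: leq_trans lej; apply: ltnW.
- by move=> i lei ik; rewrite (plift_over lG (xG i lei ik)) sapp_bd.
exists (simplex n'.+2), (yoneda s), (yoneda z); split.
- by move=> l a; rewrite /= !sapp_act pz.
- move=> l a y /= Gy; have [|i [lei ik] ai] := hits l a; first by exists y.
  have [||b aE] := @face_factor l n'.+1 i a => //.
  move: Gy; rewrite aE !act_comp -/(bd _ _) -/(bd i z) zx // => Gy.
  exact: (plift_fun lG Gy (plift_act lG b (xG _ lei ik))).
- move=> l a a' /= e; right; apply: simplex_map_eq => j; apply: injs.
    exact: (congr1 (fun t => col t j) e).
  exact: (congr1 (fun t => row t j) e).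
- move=> l l' t1 t2 r12 [d1|[a t1E]]; first by left; apply: cG r12 d1.
  change (t1 = act a s) in t1E.
  (* For a new [t1], the map [a] hits [jp], as [t1] would otherwise lie in a defined face. So [t1]
     has the pivot of [s], and all vertices of [t2] are vertices of [s]. *)
  case: (pselect (dom G t1)) => [d1|nd1]; first by left; apply: cG r12 d1.
  right; apply: prism_factor => j; case: r12 => nr1 /(_ j)[[j1 [-> ->]]|[e1 e2]].
    by rewrite t1E; exists (a j1).
  exists k; split; apply: ord_inj; rewrite ?e1 ?e2 ?k1 ?kp //.
  rewrite t1E; apply: prism_pivot_comp.
  have [i hi] : exists i, a i = jp; last by exists i; rewrite -/(row _ _) -/(col _ _) hi.
  apply: contrapT => na; apply: nd1.
  have [||b aE] := @face_factor _ n'.+1 jp a; first by rewrite -ltnS ltn_ord.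
    by move=> i; apply/negP => /eqP/ord_inj e; apply: na; exists i.
  rewrite t1E aE act_comp; apply: (dom_act _ lG); apply: bdD.
    by rewrite -ltnS ltn_ord.
  by apply/negP => /eqP/ord_inj e; move: jp0; rewrite e k1.
- exists n'.+2, (simplex_id _).
  by have -> : yoneda s n'.+2 (simplex_id _) = s by apply: (@act_id prism).
Qed.
End Lift.
End Prism.

(** * Monomorphisms times the inner 2-horn *)

(** Every set-theoretic section of a monotone surjection is monotone, so its value over [a j] can be
    prescribed. *)
Lemma simplex_section (l n : nat) (a : simplex_map l n) (j : 'I_l.+1) :
  (forall i, exists j, a j = i) ->
  exists s : simplex_map n l, s (a j) = j /\ forall i, a (s i) = i.
Proof.
move=> /choice[f fK]; pose g i := if i == a j then j else f i.
have gK i : a (g i) = i by rewrite /g; case: eqP => [->|].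
have gmono (i i' : 'I_n.+1) : i <= i' -> g i <= g i'.
  move=> ii'; case: (leqP (g i) (g i')) => // h; have := sfun_mono a (ltnW h).
  rewrite !gK => i'i; have e : i = i' by apply/ord_inj/anti_leq; rewrite ii'.
  by move: h; rewrite e ltnn.
by exists (SimplexMap gmono); split=> //=; rewrite /g eqxx.
Qed.

(** An injective monotone endomap [f] satisfies [j <= f j]. This holds for a section of [e], which
    is bijective, and for [e], its inverse. *)
Lemma simplex_map_onto_id (n : nat) (e : simplex_map n n) :
  (forall i, exists j, e j = i) -> forall j, e j = j.
Proof.
move=> onto; have ge (f : simplex_map n n) : injective f -> forall j : 'I_n.+1, j <= f j.
  move=> finj [j jn]; elim: j jn => // j IH jn; have jn' := ltnW jn.
  apply: leq_ltn_trans (IH jn') _; rewrite ltn_neqAle sfun_mono //= andbT.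
  by apply/negP => /eqP/ord_inj/finj/(congr1 val)/=; lia.
have [s [_ eK]] := simplex_section ord0 onto.
have sinj : injective s by apply: can_inj eK.
have sK : cancel e s by case: (injF_bij sinj) => g _ gK j; rewrite -(gK j) eK.
move=> j; apply/ord_inj/anti_leq; rewrite ge ?andbT; last exact: can_inj sK.
by have := ge s sinj (e j); rewrite sK.
Qed.

(** The uniqueness half of the Eilenberg-Zilber lemma. *)
Lemma eilenberg_zilber (Z : sset) (l n : nat) (z : Z n) (a b : simplex_map l n) :
  (forall i, exists j, a j = i) -> act a z = act b z -> a <> b ->
  exists e : simplex_map n n, (exists i, forall j, e j != i) /\ z = act e z.
Proof.
move=> onto e ab; have [j abj] : exists j, a j != b j.
  apply: contrapT => h; apply: ab; apply: simplex_map_eq => j.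
  by apply/eqP/negPn/negP => abj; apply: h; exists j.
(* If [simplex_comp b s] were onto it would be the identity, but it sends [a j] to [b j]. *)
have [s [sj sK]] := simplex_section j onto; exists (simplex_comp b s); split.
  apply: contrapT => h; have : simplex_comp b s (a j) = a j.
    apply: simplex_map_onto_id => i; apply: contrapT => h'; apply: h; exists i => k.
    by apply/negP => /eqP hk; apply: h'; exists k.
  by move=> /= h'; move: abj; rewrite -{1}h' sj eqxx.
rewrite act_comp -e -act_comp -[LHS]act_id; congr (act _ z).
by apply: simplex_map_eq => i; rewrite /= sK.
Qed.

Definition sprod_map (Z Z' W W' : sset) (f : smap Z Z') (g : smap W W') :
    smap (sprod Z W) (sprod Z' W').
Proof.
refine (@SMap (sprod Z W) (sprod Z' W') (fun n t => (f n t.1, g n t.2)) _).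
by move=> m n a t; rewrite /= !sapp_act.
Defined.

Definition smap_id (X : sset) : smap X X := @SMap X X (fun n x => x) (fun m n a x => erefl).

(** The cells of [Z] outside [K] are attached in order of dimension, each by
    [prism_lift]. *)
Lemma cylinder_lift (X Y Z : sset) (p : smap X Y) (v : smap (sprod Z (simplex 2)) Y)
    (K : forall n, Z n -> Prop) (G0 : prel (sprod Z (simplex 2)) X) :
  inner_fibration p -> plift p v G0 ->
  (forall m n (a : simplex_map m n) z, K n z -> K m (act a z)) ->
  (forall n (t : sprod Z (simplex 2) n), dom G0 t <-> K n t.1 \/ misses_end t.2) ->
  exists w : smap (sprod Z (simplex 2)) X,
    (forall n t, p n (w n t) = v n t) /\ forall n t x, G0 n t x -> w n t = x.
Proof.
move=> ip lG0 Kact domG0.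
(* Closedness under [R]: once one cell over [z] outside $\Lambda^2_1$ is defined, the whole cylinder
   over [z] is. *)
pose R m n (t : sprod Z (simplex 2) m) (t' : sprod Z (simplex 2) n) :=
  ~ misses_end t.2 /\ exists a : simplex_map n m, t'.1 = act a t.1.
apply: (total_lift (R := R)) => //.
  by move=> m n t t' [nm [a e]] /domG0[Kt|//]; apply/domG0; left; rewrite e; apply: Kact.
move=> G lG cG G0G n0 t0 nd0.
have missD n (z : Z n) (c : simplex_map n 2) : misses_end c -> dom G (z, c).
  move=> mc; have [|x /G0G Gx] := (domG0 n (z, c)).2; first by right.
  by exists x.
pose L n (z : Z n) := forall l (a : simplex_map l n) (c : simplex_map l 2), dom G (act a z, c).
pose P n := `[< exists z : Z n, ~ L n z >].
have exP : exists n, P n.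
  exists n0; apply/asboolP; exists t0.1 => h; apply: nd0.
  by have := h _ (simplex_id n0) t0.2; rewrite act_id; case: (t0).
case: (ex_minnP exP) => n /asboolP[z nLz] nmin {exP}.
have {}nmin l (z' : Z l) : l < n -> L l z'.
  move=> ln; apply: contrapT => h; have /nmin : P l by apply/asboolP; exists z'.
  by rewrite leqNgt ln.
have faceD l (a : simplex_map l n) c : (exists i, forall j, a j != i) ->
    dom G (act a z, c).
  case=> i ai; case: n => [|n] in z nLz nmin a i ai *.
    by have := ai ord0; rewrite !ord1.
  have [||b ->] := @face_factor l n i a; first by rewrite -ltnS ltn_ord.
    by move=> j; apply: ai.
  by rewrite act_comp; apply: nmin.
(* An onto [a] has a section, so [R] would extend the domain from [(act a z, c)] to the whole
   cylinder over [z]. Hence just the rim of that cylinder is defined. *)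
have domE l (a : simplex_map l n) (c : simplex_map l 2) :
    dom G (act a z, c) <-> (exists i, forall j, a j != i) \/ misses_end c.
  split=> [d|[|/missD //]]; last by move/faceD.
  apply: contrapT => nr; apply: nLz => k b c'; apply: cG d; split=> /=.
    by move=> mc; apply: nr; right.
  have [|s [_ sK]] := simplex_section (a := a) ord0.
    move=> i; apply: contrapT => h; apply: nr; left; exists i => j.
    by apply/negP => /eqP e; apply: h; exists j.
  exists (simplex_comp s b); rewrite -act_comp; congr (act _ z).
  by apply: simplex_map_eq => i; rewrite /= sK.
pose s := sprod_map (yoneda z) (smap_id (simplex 2)).
pose G1 : prel (sprod (simplex n) (simplex 2)) X := fun l t x => G l (s l t) x.
have lG1 : plift p (smap_comp v s) G1.
  split=> [l k a t x|l t x x'|l t x]; rewrite /G1.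
  - by move=> Gx; rewrite sapp_act; apply: (plift_act lG).
  - exact: (plift_fun lG).
  - exact: (plift_over lG).
have [|w [pw G1w]] := prism_lift ip lG1; first by move=> l [a c]; apply: domE.
exists (sprod (simplex n) (simplex 2)), s, w; split=> //.
- by move=> l q x Gx; rewrite (G1w _ _ _ Gx).
(* If [a] and [a'] differed, [z] would be of the form [act e z] with [e] not onto, and the cylinder
   over it would be defined by [faceD]. *)
- move=> l [a c] [a' c'] [ea ec]; case: (pselect (dom G (s l (a, c)))); first by left.
  move/domE => nr; right; congr (_, _) => //; apply: contrapT => aa'.
  have onto i : exists j, a j = i.
    apply: contrapT => h; apply: nr; left; exists i => j.
    by apply/negP => /eqP e; apply: h; exists j.
  have [e [[i ei] ze]] := eilenberg_zilber onto ea aa'.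
  apply: nLz => k b c0; rewrite ze -act_comp; apply: faceD.
  by exists i => j; apply: ei.
- move=> l l' t t' r [d|[[a c] tE]]; first by left; apply: cG r d.
  right; case: r => _ [b e]; exists (simplex_comp a b, t'.2).
  by rewrite [LHS]surjective_pairing e tE /= act_comp.
- apply: contrapT => h; apply: nLz => l a c; apply: contrapT => nd.
  by apply: h; exists l, (a, c).
Qed.

(** * Inner fibrations of internal homs *)

Section HornRetract.
Variables (n k : nat).
Lemma horn_sect_lt (a : nat) : (k <= a) + (k < a) < 3.
Proof. by case: (k <= a); case: (k < a). Qed.

Lemma horn_sect_mono (i j : 'I_n.+1) : i <= j ->
  Ordinal (horn_sect_lt i) <= Ordinal (horn_sect_lt j).
Proof. by rewrite /=; lia. Qed.

(** The value is 0 below [k], 1 at [k] and 2 above [k]. *)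
Definition horn_sect : simplex_map n 2 := SimplexMap horn_sect_mono.

Hypothesis kn : k <= n.

(** [Lambda^n_k -> Delta^n] is a retract of the pushout-product of
    [Lambda^n_k -> Delta^n] with [Lambda^2_1 -> Delta^2]; [horn_retr] and
    [horn_sect] are the two maps between [Delta^n * Delta^2] and [Delta^n]. *)
Definition horn_retr_fun (a c : nat) : nat :=
  if c == 0 then minn a k else if c == 1 then k else maxn a k.

Lemma horn_retr_lt (a : 'I_n.+1) (c : nat) : horn_retr_fun a c < n.+1.
Proof. by have := ltn_ord a; rewrite /horn_retr_fun; case: ifP => _; [|case: ifP]; lia. Qed.

Lemma horn_retr_mono (l : nat) (t : sprod (simplex n) (simplex 2) l) (i j : 'I_l.+1) :
  i <= j -> Ordinal (horn_retr_lt (col t i) (row t i)) <=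
            Ordinal (horn_retr_lt (col t j) (row t j)).
Proof.
move=> ij; have := col_mono t ij; have := row_mono t ij; rewrite /= /horn_retr_fun.
move: (col t i : nat) (col t j : nat) (row t i : nat) (row t j : nat) => a a' c c'.
by case: c => [|[|c]]; case: c' => [|[|c']] //=; lia.
Qed.

Definition horn_retr : smap (sprod (simplex n) (simplex 2)) (simplex n).
Proof.
refine (@SMap (sprod (simplex n) (simplex 2)) (simplex n)
  (fun l t => SimplexMap (@horn_retr_mono l t)) _).
by move=> l m a t; apply: simplex_map_eq => j; apply: ord_inj.
Defined.

Lemma horn_retrK (l : nat) (a : simplex n l) :
  horn_retr l (a, simplex_comp horn_sect a) = a.
Proof.
apply: simplex_map_eq => j; apply: ord_inj; rewrite /= /horn_retr_fun.
rewrite /col /row /=; move: (a j : nat) => x; case: (ltngtP k x) => //= h; lia.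
Qed.

(** Without row 0 all values are at least [k] and miss 0; without row 2 they are at most [k] and
    miss [n]. *)
Lemma horn_retr_misses_end (l : nat) (t : sprod (simplex n) (simplex 2) l) :
  0 < k < n -> misses_end t.2 ->
  exists i, [/\ i <= n, i != k & forall j, horn_retr l t j != i :> nat].
Proof.
case/andP=> k0 ltkn [] h.
  exists 0; split=> // [|j]; first by rewrite eq_sym -lt0n.
  have := h j; rewrite /= /horn_retr_fun -/(row t) => /negbTE ->.
  by case: ifP => _; rewrite -lt0n // leq_max k0 orbT.
exists n; split=> // [|j]; first by rewrite gtn_eqF.
have := h j; have := ltn_ord (row t j); rewrite /= /horn_retr_fun -/(row t).
move=> r3 r2; have [->|->] : row t j = 0 :> nat \/ row t j = 1 :> nat.
- by rewrite -/(row t) in r2; lia.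
- by rewrite /= ltn_eqF // gtn_min ltkn orbT.
- by rewrite /= ltn_eqF.
Qed.

Lemma horn_retr_misses (l : nat) (t : sprod (simplex n) (simplex 2) l) (i : nat) :
  i != k -> (forall j, t.1 j != i :> nat) -> forall j, horn_retr l t j != i :> nat.
Proof.
move=> ik h j; have := h j; rewrite -/(col t) /= /horn_retr_fun.
by case: ifP => _; [|case: ifP => _]; lia.
Qed.

End HornRetract.

(** By adjunction the horn is a partial lift [H] of [y] on $W\times\Lambda^N_k$. It is pulled back
    along [sh], extended by [cylinder_lift] and restricted along [horn_sect]; since [horn_sect] is a
    section of the retraction, the original problem is solved. *)
Lemma inner_fibration_sexp (X Y W : sset) (p : smap X Y) :
  inner_fibration p -> inner_fibration (sexp_post p W).
Proof.
move=> ip n k kin x y cx pxy; have kn : k <= n.+2 by lia.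
pose N := n.+2; pose Z := sprod W (simplex N).
pose H : prel Z X := fun l t e => exists i b,
  [/\ i <= N, i != k, t.2 = simplex_comp (face n.+1 i) b & e = x i l (t.1, b)].
have domH l (t : Z l) : dom H t <-> exists i, [/\ i <= N, i != k & forall j, t.2 j != i :> nat].
  split=> [[e [i [b [lei ik tE _]]]]|[i [lei ik ti]]].
    by exists i; split=> // j; rewrite tE face_neq.
  by have [b tE] := face_factor lei ti; exists (x i l (t.1, b)), i, b.
have xE i l (w : W l) b : x i l (w, b) = act b (x i) l (w, simplex_id l).
  by rewrite /=; congr (x i l (_, _)); apply: simplex_map_eq.
have lH : plift p y H.
  split=> [l m a t e [i [b [lei ik tE ->]]]|l t e e'|l t e [i [b [lei ik tE ->]]]].
  - exists i, (simplex_comp b a); split=> //=; first by rewrite tE.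
    by rewrite -sapp_act.
  - move=> [i [b [lei ik tE ->]]] [i' [b' [lei' ik' tE' ->]]]; rewrite !xE.
    by rewrite (compatible_act cx (a := b) (b := b') lei lei') // -tE tE'.
  - have := congr1 (fun u : smap (sprod W (simplex n.+1)) Y => u l (t.1, b)) (pxy i lei ik).
    by move=> /= ->; rewrite -tE; case: (t).
have shE l m (a : simplex_map l m) (t : sprod Z (simplex 2) m) :
    ((act a t).1.1, horn_retr kn l ((act a t).1.2, (act a t).2)) =
    act a ((t.1.1, horn_retr kn m (t.1.2, t.2)) : Z m) :> Z l.
  by congr (_, _); rewrite -sapp_act.
pose sh : smap (sprod Z (simplex 2)) Z := SMap shE.
pose K l (t : Z l) := exists i, [/\ i <= N, i != k & forall j, t.2 j != i :> nat].
(* The preimage of the horn under [sh] can be larger than what [cylinder_lift] asks for, so the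
   pulled back lift is cut down. *)
pose G : prel (sprod Z (simplex 2)) X := fun l t e =>
  H l (sh l t) e /\ (K l t.1 \/ misses_end t.2).
have Kact l m (a : simplex_map l m) (t : Z m) : K m t -> K l (act a t).
  by case=> i [lei ik ti]; exists i; split=> // j; apply: ti.
have [||||w [pw Gw]] := @cylinder_lift X Y Z p (smap_comp y sh) K G => //.
- split=> [l m a t e [h s]|l t e e' [h _] [h' _]|l t e [h _]].
  + split; first by rewrite sapp_act; apply: (plift_act lH).
    by case: s => [/(Kact _ _ a)|/(misses_end_comp a)]; [left|right].
  + exact: (plift_fun lH) h h'.
  + exact: (plift_over lH) h.
- move=> l t; split=> [[e []] //|h].
  have /domH[e He] : K l (sh l t); last by exists e.
  case: h => [[i [lei ik ti]]|me].
    by exists i; split=> //; apply: horn_retr_misses.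
  exact: (@horn_retr_misses_end N k kn l (t.1.2, t.2) kin me).
have zact l m (a : simplex_map l m) (t : Z m) :
    w l (act a t, simplex_comp (horn_sect n.+2 k) (act a t).2) =
    act a (w m (t, simplex_comp (horn_sect n.+2 k) t.2)).
  by rewrite -sapp_act; congr (w l (_, _)); apply: simplex_map_eq.
pose z : sexp X W N := SMap zact.
have shK l (t : Z l) : sh l (t, simplex_comp (horn_sect n.+2 k) t.2) = t.
  by case: t => a b; congr (_, _); apply: horn_retrK.
exists z; split.
  by apply: smap_eq => l t; apply: etrans (pw l _) _; apply: (congr1 (y l)); apply: shK.
move=> i lei ik; apply: smap_eq => l [a b] /=.
apply: Gw; split; last first.
  by left; exists i; split=> // j; rewrite /= eq_sym neq_bump.
by rewrite shK; exists i, b.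
Qed.

(** * Triangles in a quasi-category *)

Definition sterminal : sset.
Proof. by refine (@SSet (fun _ => unit) (fun _ _ _ _ => tt) _ _) => // n []. Defined.

Definition sto_terminal (X : sset) : smap X sterminal :=
  @SMap X sterminal (fun _ _ => tt) (fun _ _ _ _ => erefl).

Definition inner_kan (X : sset) : Prop := inner_fibration (sto_terminal X).

Lemma quasi_category_inner_kan (X : sset) : quasi_category X -> inner_kan X.
Proof.
move=> qX n k kin; have kn : k < n.+3 by lia.
apply: (@rlp_fillable _ _ _ n (Ordinal kn)) => u v uv.
have [w wE] := qX n.+2 (Ordinal kn) isT kin u.
by exists w; split=> //; apply: smap_eq => m a; case: (v m a).
Qed.

Lemma isofibration_inner (X Y : sset) (p : smap X Y) : isofibration p -> inner_fibration p.
Proof.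
case=> _ _ lift _ n k kin; have kn : k < n.+3 by lia.
exact: (@rlp_fillable _ _ _ n (Ordinal kn)) (lift n.+2 (Ordinal kn) isT kin).
Qed.

Lemma fillable_comp (X Y Z : sset) (p : smap X Y) (q : smap Y Z) n k :
  fillable p n k -> fillable q n k -> fillable (smap_comp q p) n k.
Proof.
move=> fp fq x y cx qpx.
have [||y' [qy' y'x]] := fq (fun i => p _ (x i)) y; [|exact: qpx|].
  by move=> i j ij lej ik jk; rewrite -!sapp_bd cx.
have [||z [pz zx]] := fp x y' => //; first by move=> i lei ik; rewrite y'x.
by exists z; rewrite /= pz.
Qed.

Lemma inner_kan_fibration (X Y : sset) (p : smap X Y) :
  inner_fibration p -> inner_kan Y -> inner_kan X.
Proof.
move=> ip kY n k kin.
have -> : sto_terminal X = smap_comp (sto_terminal Y) p by apply: smap_eq.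
exact: fillable_comp (ip n k kin) (kY n k kin).
Qed.

Lemma fillable_pullback (A B C : sset) (f : smap B A) (g : smap C A) n k :
  fillable g n k -> fillable (spullback_fst f g) n k.
Proof.
move=> fg x y cx xy.
have [||z [gz zx]] := fg (fun i => (sval (x i)).2) (f _ y).
- by move=> i j ij lej ik jk; apply: (congr1 (fun s => (sval s).2) (cx i j ij lej ik jk)).
- by move=> i lei ik; rewrite -(svalP (x i)) -sapp_bd -xy.
exists (exist _ (y, z) (esym gz)); split=> // i lei ik; apply: sval_eq => /=.
by rewrite [RHS]surjective_pairing -[in RHS](zx i lei ik) -/(bd i y) -xy.
Qed.

Lemma inner_kan_sexp (X W : sset) : inner_kan X -> inner_kan (sexp X W).
Proof.
move=> kX n k kin x y cx _; pose y' : sexp sterminal W n.+2 := sto_terminal _.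
have [||z [_ zx]] := @inner_fibration_sexp X sterminal W _ kX n k kin x y'.
- exact: cx.
- by move=> i lei ik; apply: smap_eq.
by exists z; split=> //; case: y.
Qed.

Definition deg (X : sset) (x : X 0) : X 1 := act (simplex_const 1 ord0) x.

Section Triangles.
Variable X : sset.
Implicit Types u v w : X 1.

Definition tri u v w : Prop := exists s : X 2, [/\ bd 2 s = u, bd 0 s = v & bd 1 s = w].

Lemma tri_ends u v w : tri u v w ->
  [/\ bd 0 u = bd 1 v, bd 1 w = bd 1 u & bd 0 w = bd 0 v].
Proof. by case=> s [<- <- <-]; split; [|apply: esym|]; apply: bd_bd. Qed.

Lemma bd_deg i (x : X 0) : bd i (deg x) = x.
Proof.
rewrite /bd /deg -act_comp -[RHS]act_id; congr (act _ x).
by apply: simplex_map_eq => j; rewrite [LHS]ord1 [RHS]ord1.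
Qed.

Lemma sdeg_lt k (i : 'I_3) : k < 2 -> i - (k < i) < 2.
Proof. by have := ltn_ord i; lia. Qed.

Lemma sdeg_mono k (k2 : k < 2) (i j : 'I_3) :
  i <= j -> Ordinal (sdeg_lt i k2) <= Ordinal (sdeg_lt j k2).
Proof. by rewrite /=; lia. Qed.

Definition sdeg k (k2 : k < 2) : simplex_map 2 1 := SimplexMap (sdeg_mono k2).

Lemma tri_degr u : tri u (deg (bd 0 u)) u.
Proof.
exists (act (@sdeg 1 isT) u).
split; [rewrite -[RHS]act_id| |rewrite -[RHS]act_id];
  rewrite /bd /deg -?act_comp; congr (act _ u);
  by apply: simplex_map_eq => -[[|[|//]] ?]; apply: ord_inj.
Qed.

Lemma tri_degl u : tri (deg (bd 1 u)) u u.
Proof.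
exists (act (@sdeg 0 isT) u).
split; [|rewrite -[RHS]act_id|rewrite -[RHS]act_id];
  rewrite /bd /deg -?act_comp; congr (act _ u);
  by apply: simplex_map_eq => -[[|[|//]] ?]; apply: ord_inj.
Qed.

End Triangles.

Lemma tri_map (X Y : sset) (f : smap X Y) u v w : tri u v w -> tri (f 1 u) (f 1 v) (f 1 w).
Proof. by case=> s [<- <- <-]; exists (f 2 s); rewrite !sapp_bd. Qed.

Lemma deg_map (X Y : sset) (f : smap X Y) x : f 1 (deg x) = deg (f 0 x).
Proof. exact: sapp_act. Qed.

Lemma horn1_lift (X Y : sset) (p : smap X Y) (u v : X 1) (s : Y 2) :
  fillable p 0 1 -> bd 0 u = bd 1 v -> p 1 u = bd 2 s -> p 1 v = bd 0 s ->
  exists s', [/\ p 2 s' = s, bd 2 s' = u & bd 0 s' = v].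
Proof.
move=> fp uv pu pv.
have [||s' [ps' s'x]] := fp (fun i => if i == 0 then v else u) s.
- by move=> [|[|[|i]]] [|[|[|j]]] //=.
- by move=> [|[|[|i]]].
by exists s'; split=> //; apply: s'x.
Qed.

Lemma horn2_lift (X Y : sset) (p : smap X Y) (v w : X 1) (s : Y 2) :
  fillable p 0 2 -> bd 0 v = bd 0 w -> p 1 v = bd 0 s -> p 1 w = bd 1 s ->
  exists s', [/\ p 2 s' = s, bd 0 s' = v & bd 1 s' = w].
Proof.
move=> fp uv pu pv.
have [||s' [ps' s'x]] := fp (fun i => if i == 0 then v else w) s.
- by move=> [|[|[|i]]] [|[|[|j]]] //=.
- by move=> [|[|[|i]]].
by exists s'; split=> //; apply: s'x.
Qed.

(** * Homotopy of edges and composition up to homotopy *)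

Section Homotopy.
Variable X : sset.
Hypothesis kX : inner_kan X.
Implicit Types a b c u v w : X 1.

Lemma tri_ex u v : bd 0 u = bd 1 v -> exists w, tri u v w.
Proof.
move=> uv; have [s [_ su sv]] := horn1_lift (s := tt : sterminal 2) (@kX 0 1 isT) uv erefl erefl.
by exists (bd 1 s), s.
Qed.

(** A 3-simplex with spine [a], [b], [c]: filling $\Lambda^3_1$ produces face 1. *)
Lemma tri_assocl a b c ab bc abc :
  tri a b ab -> tri b c bc -> tri a bc abc -> tri ab c abc.
Proof.
move=> [s3 [a3 b3 c3]] [s0 [a0 b0 c0]] [s2 [a2 b2 c2]].
have [||z [_ zx]] := @kX 1 1 isT
  (fun i => match i with 0 => s0 | 2 => s2 | _ => s3 end) tt.
- by move=> [|[|[|[|i]]]] [|[|[|[|j]]]] //= _ _ _ _; congruence.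
- by [].
exists (bd 1 z); split.
- by rewrite -(@bd_bd _ _ 1 3) // zx.
- by rewrite bd_bd // zx.
- by rewrite -(@bd_bd _ _ 1 2) // zx.
Qed.

(** The same 3-simplex, filled from $\Lambda^3_2$, with face 2 as the result. *)
Lemma tri_assocr a b c ab bc abc :
  tri a b ab -> tri b c bc -> tri ab c abc -> tri a bc abc.
Proof.
move=> [s3 [a3 b3 c3]] [s0 [a0 b0 c0]] [s1 [a1 b1 c1]].
have [||z [_ zx]] := @kX 1 2 isT
  (fun i => match i with 0 => s0 | 1 => s1 | _ => s3 end) tt.
- by move=> [|[|[|[|i]]]] [|[|[|[|j]]]] //= _ _ _ _; congruence.
- by [].
exists (bd 2 z); split.
- by rewrite -(@bd_bd _ _ 2 3) // zx.
- by rewrite bd_bd // zx.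
- by rewrite bd_bd // zx.
Qed.

Definition homotopic u v : Prop := tri u (deg (bd 0 u)) v.

Lemma homotopic_ends u v : homotopic u v -> bd 1 v = bd 1 u /\ bd 0 v = bd 0 u.
Proof. by case/tri_ends => _ -> ->; rewrite bd_deg. Qed.

(** This and the compatibilities below are cases of [tri_assocl] and [tri_assocr] with some edges
    degenerate. *)
Lemma homotopic_sym u v : homotopic u v -> homotopic v u.
Proof.
move=> uv; have [_ e] := homotopic_ends uv; rewrite /homotopic e.
apply: (tri_assocl uv _ (tri_degr u)).
by have := tri_degr (deg (bd 0 u)); rewrite bd_deg.
Qed.

Lemma tri_homotopic u v w w' : tri u v w -> tri u v w' -> homotopic w w'.
Proof.
move=> t t'; have [_ _ e] := tri_ends t; rewrite /homotopic e.
exact: tri_assocl t (tri_degr v) t'.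
Qed.

Lemma homotopic_tri u v w w' : homotopic w w' -> tri u v w -> tri u v w'.
Proof.
move=> ww' t; have [_ _ e] := tri_ends t; move: ww'; rewrite /homotopic e.
exact: tri_assocr t (tri_degr v).
Qed.

Lemma homotopic_tri1 u u' v w : homotopic u u' -> tri u v w -> tri u' v w.
Proof.
move=> uu' t; have [e _ _] := tri_ends t; apply: tri_assocl uu' _ t.
by rewrite e; apply: tri_degl.
Qed.

Lemma homotopicE u v : homotopic u v <-> tri (deg (bd 1 u)) u v.
Proof.
split=> h; first exact: tri_assocr (tri_degl u) (tri_degr u) h.
exact: tri_assocl (tri_degl u) (tri_degr u) h.
Qed.

Lemma homotopic_tri2 u v v' w : homotopic v v' -> tri u v w -> tri u v' w.
Proof.
move=> vv' t; have [_ _ e] := tri_ends t; apply: tri_assocr t vv' _.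
by rewrite -e; apply: tri_degr.
Qed.

Definition invertible u : Prop :=
  exists v, tri u v (deg (bd 1 u)) /\ tri v u (deg (bd 0 u)).

Lemma left_right_inverse a b c :
  tri a b (deg (bd 0 b)) -> tri b c (deg (bd 1 b)) -> homotopic a c.
Proof.
move=> ab bc; have [e1 e2 _] := tri_ends ab; rewrite bd_deg in e2.
have [_ _ e3] := tri_ends bc; rewrite bd_deg in e3.
apply: homotopic_sym; apply/homotopicE.
have -> : bd 1 c = bd 0 b by have [-> _ _] := tri_ends bc.
by apply: tri_assocl ab bc _; rewrite -e1; apply: tri_degr.
Qed.

End Homotopy.

(** * Two-sided inverses from one-sided ones *)

Section Inverses.
Variable X : sset.
Hypothesis kX : inner_kan X.

(** Horn lifting yields inverses on one side only. Here [a] and [c] are inverse to [b] on opposite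
    sides, hence homotopic, so [b] is a two-sided inverse of [c]. *)
Lemma invertible_of_left_inverses (a b c : X 1) :
  tri a b (deg (bd 0 b)) -> tri b c (deg (bd 0 c)) -> invertible c.
Proof.
move=> ab bc; have [e1 e2 _] := tri_ends bc; rewrite bd_deg in e2.
exists b; split=> //; rewrite -e1.
apply: homotopic_tri1 (ab) => //; apply: left_right_inverse ab _ => //.
by rewrite -e2.
Qed.

Lemma invertible_of_right_inverses (a b c : X 1) :
  tri a b (deg (bd 1 a)) -> tri b c (deg (bd 1 b)) -> invertible a.
Proof.
move=> ab bc; have [e1 _ e2] := tri_ends ab; rewrite bd_deg in e2.
exists b; split=> //; rewrite e1.
apply: homotopic_tri2 (bc) => //; apply: homotopic_sym => //.
by apply: left_right_inverse bc => //; rewrite -e2.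
Qed.

Lemma invertible_inverse (u v : X 1) :
  tri u v (deg (bd 1 u)) -> tri v u (deg (bd 0 u)) -> invertible v.
Proof.
move=> uv vu; exists u; have [e1 _ _] := tri_ends uv; have [e2 _ _] := tri_ends vu.
by rewrite -e1 e2.
Qed.

Lemma invertible_right_inverse (u v : X 1) :
  invertible u -> tri u v (deg (bd 1 u)) -> invertible v.
Proof.
move=> [i [ui iu]] uv; have [e1 _ e2] := tri_ends uv; rewrite bd_deg in e2.
exists u; split; last by rewrite -e2.
rewrite -e1; apply: homotopic_tri1 (iu) => //; exact: left_right_inverse iu uv.
Qed.

End Inverses.

Lemma invertible_map (X Y : sset) (f : smap X Y) (u : X 1) :
  invertible u -> invertible (f 1 u).
Proof.
case=> v [/(tri_map f) + /(tri_map f)]; rewrite !deg_map !sapp_bd => uv vu.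
by exists (f 1 v).
Qed.

(** Left inverses lift along [Lambda^2_2 -> Delta^2], and so do their left
    inverses. *)
Lemma invertible_reflect (X Y : sset) (p : smap X Y) (e : X 1) :
  inner_kan X -> fillable p 0 2 -> invertible (p 1 e) -> invertible e.
Proof.
move=> kX fp.
have step (u : X 1) : invertible (p 1 u) ->
    exists v, tri v u (deg (bd 0 u)) /\ invertible (p 1 v).
  case=> i [ui iu]; have [s [s2 s0 s1]] := iu.
  have [|||s' [ps' s'0 s'1]] := @horn2_lift _ _ p u (deg (bd 0 u)) s fp => //.
  - by rewrite bd_deg.
  - by rewrite deg_map s1 sapp_bd.
  exists (bd 2 s'); split; first by exists s'.
  by rewrite sapp_bd ps' s2; apply: invertible_inverse ui iu.
by move=> /step[u [ue /step[u' [u'u _]]]]; apply: invertible_of_left_inverses u'u ue.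
Qed.

(** * Decalage and special outer horns *)

Section Decalage.

Lemma cone_lt (m n : nat) (a : simplex_map m n) (i : 'I_m.+2) :
  (if i <= m then a (inord i) : nat else n.+1) < n.+2.
Proof. by case: ifP => // _; apply: ltnW; rewrite ltnS ltn_ord. Qed.

Lemma cone_mono (m n : nat) (a : simplex_map m n) (i j : 'I_m.+2) :
  i <= j -> Ordinal (cone_lt a i) <= Ordinal (cone_lt a j).
Proof.
move=> ij /=; case: (leqP j m) => jm.
  by rewrite (leq_trans ij jm); apply: sfun_mono; rewrite !inordK //; lia.
by case: ifP => // _; apply: ltnW; rewrite ltn_ord.
Qed.

(** The join of [a] with the identity of [Delta^0]. *)
Definition cone_map (m n : nat) (a : simplex_map m n) : simplex_map m.+1 n.+1 :=
  SimplexMap (cone_mono a).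

Lemma cone_map_id (n : nat) : cone_map (simplex_id n) = simplex_id n.+1.
Proof.
apply: simplex_map_eq => i; apply: ord_inj => /=; case: leqP => h.
  by rewrite inordK.
by have := ltn_ord i; lia.
Qed.

Lemma cone_map_comp (l m n : nat) (b : simplex_map m n) (a : simplex_map l m) :
  cone_map (simplex_comp b a) = simplex_comp (cone_map b) (cone_map a).
Proof.
apply: simplex_map_eq => i; apply: ord_inj => /=; case: (leqP i l) => h.
  by rewrite -ltnS ltn_ord inord_val.
by rewrite ltnn.
Qed.

Lemma cone_map_face (n i : nat) : i <= n.+1 -> cone_map (face n i) = face n.+1 i.
Proof.
move=> lei; apply: simplex_map_eq => j; apply: ord_inj => /=.
have jn := ltn_ord j; case: leqP => h; first by rewrite inordK.
by rewrite /bump; lia.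
Qed.

Lemma cone_map_base (m n : nat) (a : simplex_map m n) :
  simplex_comp (cone_map a) (face m m.+1) = simplex_comp (face n n.+1) a.
Proof.
apply: simplex_map_eq => j; apply: ord_inj => /=.
have := ltn_ord j; have := ltn_ord (a j) => ? ?.
have e x y : x < y.+1 -> bump y.+1 x = x by rewrite /bump; lia.
by rewrite !e // -ltnS ltn_ord inord_val.
Qed.

Variable A : sset.

(** The disjoint union of the slices $A_{/d}$ over all vertices [d]: the last vertex of a simplex is
    the cone point, kept fixed by the operators. *)
Definition decalage : sset.
Proof.
refine (@SSet (fun n => A n.+1) (fun m n a x => act (cone_map a) x) _ _).
- by move=> n x; rewrite cone_map_id act_id.
- by move=> l m n b a x; rewrite cone_map_comp act_comp.
Defined.

Definition dec_proj : smap decalage A.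
Proof.
refine (@SMap decalage A (fun n x => bd n.+1 x) _).
by move=> m n a x; rewrite /bd /= -!act_comp cone_map_base.
Defined.

Lemma bd_dec (n i : nat) (x : A n.+2) : i <= n.+1 ->
  bd i (x : decalage n.+1) = bd i x :> A n.+1.
Proof. by move=> lei; rewrite /bd /= cone_map_face. Qed.

(** Face data one dimension up in [A]: the base [b] becomes face [n.+3], opposite the cone point. *)
Definition dec_faces (n : nat) (x : nat -> decalage n.+1) (b : A n.+2) (i : nat) : A n.+2 :=
  if i < n.+3 then x i else b.

Lemma dec_faces_compatible (n k : nat) (x : nat -> decalage n.+1) (b : A n.+2) :
  compatible k x ->
  (forall i, i <= n.+2 -> i != k -> dec_proj n.+1 (x i) = bd i b) ->
  @compatible A n.+1 k (dec_faces x b).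
Proof.
move=> cx xb i j ij lej ik jk; rewrite /dec_faces; have -> : i < n.+3 by lia.
case: ltnP => h.
  by have := cx i j ij h ik jk; rewrite !bd_dec //; lia.
have -> : j = n.+3 by lia.
by apply/esym/xb => //; lia.
Qed.

End Decalage.

(** The bound on [k] admits the outer horn [k = n.+2]: it becomes inner in [A] because the cone
    point comes after it. *)
Lemma dec_proj_fillable (A : sset) (n k : nat) :
  inner_kan A -> 0 < k < n.+3 -> fillable (dec_proj A) n k.
Proof.
move=> kA kn x b cx xb.
have [||z [_ zx]] := kA n.+1 k kn (dec_faces x b) tt => //.
  exact: dec_faces_compatible.
exists z; split; first by rewrite /= zx /dec_faces ?ltnn //; lia.
by move=> i lei ik; rewrite bd_dec // zx //; [rewrite /dec_faces ltnS lei | lia].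
Qed.

Lemma dec_proj_inner (A : sset) : inner_kan A -> inner_fibration (dec_proj A).
Proof. by move=> kA n k kn; apply: dec_proj_fillable => //; lia. Qed.

Section Slice.
Variables (C A : sset) (r : smap C A).

Let Q := spullback r (dec_proj A).

(** The comparison of slices [C/d -> C *_A A/(r d)], for all vertices [d] of
    [C] at once. *)
Definition dec_cmp : smap (decalage C) Q.
Proof.
refine (@SMap (decalage C) Q
  (fun n x => exist _ (bd n.+1 x, r n.+1 x) (sapp_bd r n.+1 x)) _).
move=> m n a x; apply: sval_eq; congr (_, _); first exact: (sapp_act (dec_proj C)).
exact: (sapp_act r (cone_map a)).
Defined.

(** A lifting problem for [r] one dimension up, whose face opposite the cone point is the
    [C]-component of [y]. *)
Lemma dec_cmp_fillable (n k : nat) : inner_fibration r -> 0 < k < n.+2 ->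
  fillable dec_cmp n k.
Proof.
move=> ir kn x y cx xy.
have [|||z [rz zx]] := ir n.+1 k _ (dec_faces x (sval y).1) (sval y).2; first by lia.
- apply: dec_faces_compatible => // i lei ik.
  exact: (congr1 (fun s : Q n.+1 => (sval s).1) (xy i lei ik)).
- move=> i lei ik; rewrite /dec_faces; case: ltnP => h.
    have := congr1 (fun s : Q n.+1 => (sval s).2) (xy i h ik) => /= ->.
    exact: bd_dec.
  have -> : i = n.+3 by lia.
  by rewrite (svalP y).
exists z; split.
  apply: sval_eq; rewrite /= rz zx /dec_faces ?ltnn //; last by lia.
  by case: (y) => -[].
by move=> i lei ik; rewrite bd_dec // zx //; [rewrite /dec_faces ltnS lei | lia].
Qed.

(** The edge [(v, t)] of [Q] is invertible, as [Q -> C] reflects invertibility.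
    Its inverse lifts along [decalage C -> Q] to an edge ending at [z], whose own
    inverse starts at [z] and lies over an edge homotopic to [(v, t)]; lifting
    the homotopy corrects it. *)
Lemma special_outer_horn (v z : C 1) (t : A 2) :
  inner_kan A -> inner_kan C -> inner_fibration r -> invertible v ->
  bd 1 v = bd 1 z -> r 1 v = bd 2 t -> r 1 z = bd 1 t ->
  exists s, [/\ r 2 s = t, bd 2 s = v & bd 1 s = z].
Proof.
move=> kA kC ir iv vz rv rz; pose pr := spullback_fst r (dec_proj A).
have ipr : inner_fibration pr.
  by move=> n k kn; apply: fillable_pullback; apply: dec_proj_inner.
have kQ : inner_kan Q := inner_kan_fibration ipr kC.
have kD : inner_kan (decalage C) := inner_kan_fibration (dec_proj_inner kC) kC.
pose e : Q 1 := exist _ (v, t) rv.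
have ie : invertible e.
  apply: (invertible_reflect (p := pr)) => //.
  by apply: fillable_pullback; apply: dec_proj_fillable.
have [i [ei ie']] := ie.
have [e1 _ e2] := tri_ends ei; rewrite bd_deg in e2.
have [||| s [rs s2 s0]] := @horn1_lift _ _ r (sval i).1 z (sval i).2 (ir 0 1 isT).
- by rewrite -vz; apply: (congr1 (fun q : Q 0 => (sval q).1) (esym e2)).
- exact: (svalP i).
- rewrite rz -(@bd_dec A 0 1) // -(@bd_dec A 0 0) //.
  exact: (congr1 (fun q : Q 0 => (sval q).2) e2).
have si : dec_cmp 1 s = i by apply: sval_eq; rewrite /= s2 rs; case: (i) => -[].
(* [dec_proj C] reflects invertibility and sends [s] to the first component of [i], which is
   invertible because [i] is an inverse of [e]. *)
have [j [sj js]] : invertible (s : decalage C 1).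
  apply: (invertible_reflect (p := dec_proj C)) => //; first exact: dec_proj_fillable.
  rewrite -[dec_proj C 1 s]/(bd 2 s) s2; apply: (invertible_map pr).
  exact: invertible_inverse ei ie'.
have je : homotopic (dec_cmp 1 j) e.
  apply: homotopic_sym => //; apply: (@left_right_inverse _ kQ _ i); first by rewrite -e2.
  by have := tri_map dec_cmp sj; rewrite si deg_map sapp_bd si.
have [u [u2 u0 u1]] := je.
have [|||| s' [qs' s'2 s'0]] := @horn1_lift _ _ dec_cmp j (deg (bd 0 j)) u.
- exact: dec_cmp_fillable.
- by rewrite bd_deg.
- by rewrite u2.
- by rewrite deg_map sapp_bd u0.
have jf : homotopic j (bd 1 s') by exists s'.
have fe : dec_cmp 1 (bd 1 s') = e by rewrite sapp_bd qs'.
exists (bd 1 s' : decalage C 1); split.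
- exact: (congr1 (fun q : Q 1 => (sval q).2) fe).
- exact: (congr1 (fun q : Q 1 => (sval q).1) fe).
rewrite -(@bd_dec C 0 1) // (homotopic_ends jf).1.
have [_ + _] := tri_ends js; rewrite bd_deg => <-.
by rewrite bd_dec.
Qed.

End Slice.

(** * The homotopy category of a quasi-category *)

Section EdgeClasses.
Variable X : sset.

Lemma bd1E (e : X 1) : bd 1 e = act (simplex_const 0 ord0) e.
Proof. by congr (act _ e); apply: simplex_map_eq => j; apply: ord_inj; rewrite ord1. Qed.

Lemma bd0E (e : X 1) : bd 0 e = act (simplex_const 0 ord_max) e.
Proof. by congr (act _ e); apply: simplex_map_eq => j; apply: ord_inj; rewrite ord1. Qed.

Lemma edge_src (x y : X 0) (e : edge x y) : bd 1 (sval e) = x.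
Proof. by rewrite bd1E; case: e => e []. Qed.

Lemma edge_tgt (x y : X 0) (e : edge x y) : bd 0 (sval e) = y.
Proof. by rewrite bd0E; case: e => e []. Qed.

Lemma edge_mk (x y : X 0) (e : X 1) : bd 1 e = x -> bd 0 e = y ->
  exists e' : edge x y, sval e' = e.
Proof. by rewrite bd1E bd0E => ex ey; exists (exist _ e (conj ex ey)). Qed.

Lemma triP (x y z : X 0) (u : edge x y) (v : edge y z) (w : edge x z) :
  tri (sval u) (sval v) (sval w) <-> exists s : X 2,
    [/\ act (coface ord_max) s = sval u, act (coface ord0) s = sval v
      & act (coface (inord 1)) s = sval w].
Proof.
have cE (k : 'I_3) : coface k = face 1 k.
  by apply: simplex_map_eq => j; apply: ord_inj.
have bE (s : X 2) : act (coface (inord 1)) s = bd 1 s by rewrite cE inordK.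
by split=> -[s [su sv sw]]; exists s; move: su sv sw; rewrite bE !cE.
Qed.

(** A relation, since composites are determined only up to homotopy; the empty path has all edges
    homotopic to the degenerate one. *)
Fixpoint composite (x y : X 0) (p : edge_path x y) (e : X 1) : Prop :=
  match p with
  | enil x => tri (deg x) (deg x) e
  | econs _ _ _ u p' => exists2 e', composite p' e' & tri (sval u) e' e
  end.

Lemma composite_ends (x y : X 0) (p : edge_path x y) e :
  composite p e -> bd 1 e = x /\ bd 0 e = y.
Proof.
elim: p e => [{}x|{}x {}y z u p IH] e /=.
  by case/tri_ends; rewrite !bd_deg.
by case=> e' /IH[_ <-] /tri_ends[_ -> ->]; rewrite edge_src.
Qed.

Lemma composite_path_rel (x y : X 0) (p : edge_path x y) (e : edge x y) :
  composite p (sval e) -> path_rel p (eone e).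
Proof.
elim: p e => [{}x|{}x {}y z u p IH] e /=.
  rewrite -[deg x]/(sval (degenerate_edge x)) => /triP[s [s2 s0 s1]].
  apply: path_rel_trans (path_rel_triangle s2 s0 s1).
  have := path_rel_sym (path_rel_degenerate x).
  by move=> h; have := path_rel_cat h h.
case=> e' pe' t; have [e1 e0] := composite_ends pe'.
have [v vE] := edge_mk e1 e0; rewrite -vE in pe' t.
have /triP[s [s2 s0 s1]] := t.
apply: path_rel_trans (path_rel_triangle s2 s0 s1).
by apply: (path_rel_cat (path_rel_refl (eone u))); apply: IH.
Qed.

Hypothesis kX : inner_kan X.

Lemma composite_ex (x y : X 0) (p : edge_path x y) : exists e, composite p e.
Proof.
elim: p => [{}x|{}x {}y z u p [e pe]] /=.
  by apply: tri_ex => //; rewrite !bd_deg.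
have [|e' t] := @tri_ex _ kX (sval u) e; last by exists e', e.
by rewrite edge_tgt (composite_ends pe).1.
Qed.

Lemma composite_homotopic (x y : X 0) (p : edge_path x y) e e' :
  composite p e -> composite p e' -> homotopic e e'.
Proof.
elim: p e e' => [{}x|{}x {}y z u p IH] e e' /=; first exact: tri_homotopic.
move=> [d pd t] [d' pd' t']; apply: tri_homotopic (t') => //.
exact: homotopic_tri2 (IH _ _ pd pd') t.
Qed.

Lemma homotopic_composite (x y : X 0) (p : edge_path x y) e e' :
  homotopic e e' -> composite p e -> composite p e'.
Proof.
move=> ee'; case: p => [{}x|{}x {}y z u p] /=; first exact: homotopic_tri.
by case=> d pd t; exists d => //; apply: homotopic_tri ee' t.
Qed.

Lemma composite_enil (x : X 0) : composite (enil x) (deg x).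
Proof. by have := tri_degr (deg x); rewrite bd_deg. Qed.

Lemma composite_eone (x y : X 0) (u : edge x y) : composite (eone u) (sval u).
Proof.
exists (deg y); first exact: composite_enil.
by have := tri_degr (sval u); rewrite edge_tgt.
Qed.

Lemma composite_cat (x y z : X 0) (p : edge_path x y) (q : edge_path y z) a b c :
  composite p a -> composite q b -> tri a b c -> composite (ecat p q) c.
Proof.
elim: p q a c => [{}x|{}x {}y w u p IH] q a c /=.
  move=> xa qb t; have [b1 _] := composite_ends qb.
  apply: homotopic_composite qb; apply/homotopicE => //; rewrite b1.
  apply: homotopic_tri1 t => //; apply: homotopic_sym => //.
  by rewrite /homotopic bd_deg.
case=> a' pa' ta qb t; have [_ e0] := composite_ends pa'.
have [|d td] := @tri_ex _ kX a' b; first by rewrite e0 (composite_ends qb).1.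
by exists d; [apply: IH td | apply: tri_assocr ta td t].
Qed.

(** Each generating relation joins paths with a common composite, and the closure rules keep this
    because composites of a path are unique up to homotopy. Equality of classes thus becomes the
    existence of a triangle. *)
Lemma path_rel_composite (x y : X 0) (p q : edge_path x y) :
  path_rel p q -> exists a, composite p a /\ composite q a.
Proof.
elim=> {x y p q}.
- by move=> x y p; have [a pa] := composite_ex p; exists a.
- by move=> x y p q _ [a [pa qa]]; exists a.
- move=> x y p q r _ [a [pa qa]] _ [b [qb rb]]; exists b; split=> //.
  exact: homotopic_composite (composite_homotopic qa qb) pa.
- move=> x y z p p' q q' _ [a [pa pa']] _ [b [qb qb']].
  have [|c t] := @tri_ex _ kX a b.
    by rewrite (composite_ends pa).2 (composite_ends qb).1.
  by exists c; split; apply: composite_cat t.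
- move=> x; exists (deg x); split; last exact: composite_enil.
  exact: (composite_eone (degenerate_edge x)).
- move=> x y z u v w s su sv sw; exists (sval w); split; last exact: composite_eone.
  apply: composite_cat (composite_eone u) (composite_eone v) _.
  by apply/triP; exists s.
Qed.

Lemma hclass_edge (x y : X 0) (h : hhom x y) : exists e : edge x y, h = hclass (eone e).
Proof.
have [e pe] := composite_ex (hrepr h); have [e1 e0] := composite_ends pe.
have [u uE] := edge_mk e1 e0; exists u; rewrite -[h]hreprK.
by apply/hclassP/composite_path_rel; rewrite uE.
Qed.

Lemma hclass_composite (x y : X 0) (p : edge_path x y) (e : edge x y) :
  hclass p = hclass (eone e) <-> composite p (sval e).
Proof.
split=> [/hclassP/path_rel_composite[a [pa ea]]|pe]; last first.
  by apply/hclassP/composite_path_rel.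
exact: homotopic_composite (composite_homotopic ea (composite_eone e)) pa.
Qed.

Lemma hclass_homotopic (x y : X 0) (e e' : edge x y) :
  homotopic (sval e) (sval e') <-> hclass (eone e) = hclass (eone e').
Proof.
split=> [h|/hclass_composite h].
  by apply/hclass_composite; apply: homotopic_composite h (composite_eone e).
exact: composite_homotopic (composite_eone e) h.
Qed.

Lemma hclass_tri (x y z : X 0) (u : edge x y) (v : edge y z) (w : edge x z) :
  hclass (ecat (eone u) (eone v)) = hclass (eone w) <-> tri (sval u) (sval v) (sval w).
Proof.
split=> [/hclass_composite h|t]; last first.
  apply/hclass_composite.
  exact: composite_cat (composite_eone u) (composite_eone v) t.
have [|c t] := @tri_ex _ kX (sval u) (sval v); first by rewrite edge_src edge_tgt.
apply: homotopic_tri (t) => //; apply: composite_homotopic h.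
exact: composite_cat (composite_eone u) (composite_eone v) t.
Qed.

Lemma hclass_enil (x : X 0) : hclass (enil x) = hclass (eone (degenerate_edge x)).
Proof. by apply/hclass_composite; apply: composite_enil. Qed.

Lemma arr_homotopic (x y x' y' : X 0) (e : edge x y) (e' : edge x' y') :
  @arr (hcat X) x y (hclass (eone e)) = @arr (hcat X) x' y' (hclass (eone e')) ->
  homotopic (sval e) (sval e').
Proof.
move=> ee'; pose P (a b : hcat X) (h : @hom (hcat X) a b) :=
  forall d : edge a b, h = hclass (eone d) -> homotopic (sval e) (sval d).
by apply: (arr_ind (P := P) _ ee') => // d /hclass_homotopic.
Qed.

Lemma is_iso_invertible (x y : X 0) (e : edge x y) :
  @is_iso (hcat X) x y (hclass (eone e)) <-> invertible (sval e).
Proof.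
split=> [[h []]|[i [ei ie]]].
  have [i -> {h}] := hclass_edge h; rewrite /= !hcomp_class !hclass_enil.
  move=> /hclass_tri ei /hclass_tri ie.
  by exists (sval i); rewrite edge_src edge_tgt.
have [i1 i2 i3] := tri_ends ei; rewrite !bd_deg edge_src edge_tgt in i1 i2 i3.
have [d dE] := edge_mk (esym i1) (esym i3); exists (hclass (eone d)).
rewrite /= !hcomp_class !hclass_enil; split; apply/hclass_tri; rewrite dE.
  by have := ei; rewrite edge_src.
by have := ie; rewrite edge_tgt.
Qed.

End EdgeClasses.

(** * Pullback squares *)

Section PullbackSquare.
Variables (A B C P : sset) (f : smap B A) (g : smap C A) (p : smap P B) (q : smap P C).
Hypothesis sq : forall n (x : P n), f n (p n x) = g n (q n x).
Hypothesis pb_ex : forall n b c, f n b = g n c -> exists x : P n, p n x = b /\ q n x = c.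
Hypothesis pb_inj : forall n (x x' : P n), p n x = p n x' -> q n x = q n x' -> x = x'.
Hypotheses (kA : inner_kan A) (kB : inner_kan B) (kC : inner_kan C) (kP : inner_kan P).
Hypothesis ig : inner_fibration g.

(** [step] yields a right inverse that satisfies the same hypotheses; using it twice gives the chain
    for [invertible_of_right_inverses]. *)
Lemma invertible_pullback (w : P 1) :
  invertible (p 1 w) -> invertible (q 1 w) -> invertible w.
Proof.
have step (u : P 1) : invertible (p 1 u) -> invertible (q 1 u) ->
    exists v, [/\ tri u v (deg (bd 1 u)), invertible (p 1 v) & invertible (q 1 v)].
  move=> iu iv; have [u' [uu' u'u]] := iu; have [s [s2 s0 s1]] := uu'.
  (* The horn has first edge [q 1 u] and a degenerate long edge, so the remaining edge of [t] is a
     right inverse of [q 1 u] lying over the image of [u']. *)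
  have [|||t [gt t2 t1]] := @special_outer_horn _ _ g (q 1 u) (deg (bd 1 (q 1 u))) (f 2 s)
    kA kC ig iv.
  - by rewrite bd_deg.
  - by rewrite -sq -s2 sapp_bd.
  - by rewrite deg_map -!sapp_bd s1 -sq deg_map !sapp_bd.
  have [x [px qx]] := pb_ex (esym gt).
  exists (bd 0 x); rewrite !sapp_bd px qx s0; split; last 1 first.
  - by apply: (invertible_right_inverse kC iv); exists t; split.
  - exists x; split=> //; apply: pb_inj;
      by rewrite ?deg_map !sapp_bd ?px ?qx // deg_map sapp_bd.
  - exact: invertible_inverse uu' u'u.
move=> /step h /h [v [wv /step{}h /h[v' [vv' _ _]]]].
exact: invertible_of_right_inverses wv vv'.
Qed.

(** [pb_ex] and [pb_inj] state the pullback property cell by cell, the form in which it holds for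
    exponentials of a [spullback]. *)
Lemma pullback_smothering (hsq : fcomp (hmap f) (hmap p) = fcomp (hmap g) (hmap q)) :
  smothering (cat_pair hsq).
Proof.
split.
- move=> [[b c] e]; have [x [px qx]] := pb_ex (e : f 0 b = g 0 c).
  by exists x; apply: sval_eq; rewrite /= px qx.
- move=> a b [[h1 h2] e]; have [u hu] := hclass_edge kB h1; have [v hv] := hclass_edge kC h2.
  subst h1 h2.
  have uv : homotopic (f 1 (sval u)) (g 1 (sval v)).
    apply: (@arr_homotopic _ kA _ _ _ _ (map_edge f u) (map_edge g v)).
    by rewrite -(hmap_class f (eone u)) -(hmap_class g (eone v)).
  (* The homotopy is reversed so that its lift can start at [sval v]. The lift ends at an edge
     homotopic to [sval v] and lying strictly over [f 1 (sval u)], which pairs with [sval u] to an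
     edge of [P]. *)
  have {uv} [s [s2 s0 s1]] := homotopic_sym kA uv.
  have [|||t [gt t2 t0]] := @horn1_lift _ _ g (sval v) (deg (bd 0 (sval v))) s (@ig 0 1 isT).
  - by rewrite bd_deg.
  - by rewrite s2.
  - by rewrite deg_map sapp_bd s0.
  have vt : homotopic (sval v) (bd 1 t) by exists t.
  have [t1 t1'] := homotopic_ends vt.
  have [w wE] := edge_mk (etrans t1 (edge_src v)) (etrans t1' (edge_tgt v)).
  have [x [px qx]] : exists x, p 1 x = sval u /\ q 1 x = sval w.
    by apply: pb_ex; rewrite wE sapp_bd gt s1.
  have [||d dE] := @edge_mk P a b x.
  - by apply: pb_inj; rewrite sapp_bd ?px ?qx edge_src.
  - by apply: pb_inj; rewrite sapp_bd ?px ?qx edge_tgt.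
  exists (hclass (eone d)); apply: sval_eq; rewrite /=; congr (_, _).
    rewrite [LHS](hmap_class p (eone d)); congr (hclass (eone _)).
    by apply: sval_eq; rewrite /= dE px.
  rewrite [LHS](hmap_class q (eone d)); apply/(hclass_homotopic kC).
  by apply: homotopic_sym => //; rewrite /= dE qx wE.
- move=> a b h; have [d -> {h}] := hclass_edge kP h.
  move=> [[[i1 i2] ei] [e1 e2]]; apply/(is_iso_invertible kP).
  have e11 := congr1 (fun w => (sval w).1) e1; have e12 := congr1 (fun w => (sval w).2) e1.
  have e21 := congr1 (fun w => (sval w).1) e2; have e22 := congr1 (fun w => (sval w).2) e2.
  apply: invertible_pullback.
    apply/(is_iso_invertible kB (map_edge p d)); exists i1.
    by rewrite -(hmap_class p (eone d)).
  apply/(is_iso_invertible kC (map_edge q d)); exists i2.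
  by rewrite -(hmap_class q (eone d)).
Qed.
End PullbackSquare.

(** The [B]-component of the horn is filled first; the [C]-component is then lifted along [g] over
    the image of that filler. *)
Lemma spullback_quasi_category (A B C : sset) (f : smap B A) (g : smap C A) :
  quasi_category B -> isofibration g -> quasi_category (spullback f g).
Proof.
move=> qB [_ _ lift _] n k n2 kn u.
have [b bu] := qB n k n2 kn (smap_comp (spullback_fst f g) u).
have [|c [cu gc]] := lift n k n2 kn (smap_comp (spullback_snd f g) u) (smap_comp f b).
  apply: smap_eq => m a /=; rewrite -(svalP (u m a)).
  by congr (f m _); have := congr1 (fun s : smap (horn k) B => s m a) bu.
have bc m (a : simplex n m) : f m (b m a) = g m (c m a).
  by have := congr1 (fun s : smap (simplex n) A => s m a) gc.
pose w m (a : simplex n m) : spullback f g m := exist _ (b m a, c m a) (bc m a).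
have wact l m (a : simplex_map l m) x : w l (act a x) = act a (w m x).
  by apply: sval_eq; rewrite /= !sapp_act.
exists (SMap wact); apply: smap_eq => m a; apply: sval_eq => /=.
rewrite [RHS]surjective_pairing; congr (_, _).
  exact: (congr1 (fun s : smap (horn k) B => s m a) bu).
exact: (congr1 (fun s : smap (horn k) C => s m a) cu).
Qed.

Theorem proposition3p3p14 (A B C : sset) (f : smap B A) (g : smap C A) :
  quasi_category A -> quasi_category B -> quasi_category C -> isofibration g ->
  quasi_category (spullback f g) /\
  weak_2_pullback (spullback_comm f g).
Proof.
move=> qA qB qC isog; have qP := spullback_quasi_category (f := f) qB isog; split=> // X _.
have kan Y : quasi_category Y -> inner_kan (sexp Y X).
  by move=> qY; apply: inner_kan_sexp; apply: quasi_category_inner_kan.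
apply: pullback_smothering; try exact: kan.
- move=> n x; apply: smap_eq => m y; exact: (svalP (x m y)).
- move=> n b c bc.
  have e m y : f m (b m y) = g m (c m y).
    by have := congr1 (fun s : smap (sprod X (simplex n)) A => s m y) bc.
  pose x m y : spullback f g m := exist _ (b m y, c m y) (e m y).
  have xact l m (a : simplex_map l m) y : x l (act a y) = act a (x m y).
    by apply: sval_eq; rewrite /= !sapp_act.
  by exists (SMap xact); split; apply: smap_eq.
- move=> n x x' e1 e2; apply: smap_eq => m y; apply: sval_eq.
  rewrite [LHS]surjective_pairing [RHS]surjective_pairing; congr (_, _).
    exact: (congr1 (fun s : smap (sprod X (simplex n)) B => s m y) e1).
  exact: (congr1 (fun s : smap (sprod X (simplex n)) C => s m y) e2).
- exact/inner_fibration_sexp/isofibration_inner.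
Qed.
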